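(* Let $d=(d_n)_{n\in\mathbb{N}_0}$ be an increasing sequence with $d_n\ge1$ for all $n$ and $d_n\uparrow\infty$, such that for each $m\in\mathbb{N}_0$ the sequence $\big(\frac{d_{m+k+1}}{d_k}\big)_{k\in\mathbb{N}_0}$ is decreasing and such that $\frac{d_{k+1}}{d_k}\downarrow1$ as $k\to\infty$. Then, for every $t\in[0,1)$, the operator $C_t\in\mathcal{L}(h_d)$ is compact with spectra $$\sigma_{pt}(C_t;h_d)=\Lambda\quad\text{and}\quad\sigma(C_t;h_d)=\Lambda_0.$$ Furthermore, $C_t$ is power bounded and uniformly mean ergodic in $h_d$, but not supercyclic.
   Context: Sequences are complex and indexed by $\mathbb{N}_0=\{0,1,2,\dots\}$; ''increasing'' and ''decreasing'' are not required to be strict. The generalized Hahn space $h_d$ is the Banach space of all $x\in c_0$ (null sequences) with $\|x\|_{h_d}:=\sum_{k=0}^\infty d_k|x_{k+1}-x_k|<\infty$. For $t\in[0,1]$ the generalized Cesàro operator is $C_tx=\big(\frac{t^nx_0+t^{n-1}x_1+\dots+x_n}{n+1}\big)_{n\in\mathbb{N}_0}$, with $t^0=1$ also for $t=0$. $\Lambda:=\{\frac1{n+1}:n\in\mathbb{N}_0\}$ and $\Lambda_0:=\Lambda\cup\{0\}$. $\mathcal{L}(X)$ is the space of bounded linear operators on a Banach space $X$; $\sigma(T;X)$ and $\sigma_{pt}(T;X)$ are the spectrum and point spectrum (set of eigenvalues) of $T$. With $T_{[n]}:=\frac1n\sum_{m=1}^nT^m$, $T$ is uniformly mean ergodic if $(T_{[n]})_{n\geq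 1}$ converges in operator norm; power bounded if $\sup_{n\ge1}\|T^n\|<\infty$; supercyclic if there is $x\in X$ with $\{\lambda T^nx:\lambda\in\mathbb{C},n\in\mathbb{N}_0\}$ dense in $X$. *)

(* Defs.v *)
From Stdlib Require Import Reals Lra Lia List.
From Stdlib Require Import FunctionalExtensionality PropExtensionality.
From Stdlib Require Import ProofIrrelevance IndefiniteDescription.
From Coquelicot Require Import Coquelicot.

Open Scope R_scope.

(* Only d_n >= 1 is needed for h_d to be a Banach space, so the
   type takes no other assumption on d; the proof of d_n >= 1 is a parameter so
   that the canonical structures below can be inferred from the type. *)
Record hahn (d : nat -> R) (d_ge1 : forall n : nat, 1 <= d n) : Type := Hahn {
  hseq :> nat -> C;
  hahn_null : is_lim_seq (fun n => Cmod (hseq n)) 0;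
  hahn_summable :
    ex_series (fun k => d k * Cmod (hseq (S k) - hseq k)%C) }.

Arguments Hahn {d d_ge1} hseq _ _.
Arguments hseq {d d_ge1} h n.
Arguments hahn_null {d d_ge1} h.
Arguments hahn_summable {d d_ge1} h.

Section HahnSpace.

Variable d : nat -> R.
Hypothesis d_ge1 : forall n : nat, 1 <= d n.

Local Notation hd := (hahn d d_ge1).

Definition hahn_norm (x : hd) : R :=
  Series (fun k => d k * Cmod (x (S k) - x k)%C).

Lemma hahn_eq (x y : hd) : (forall n, x n = y n) -> x = y.
Proof.
destruct x as [x x1 x2], y as [y y1 y2]; simpl; intros H.
assert (E : x = y) by (apply functional_extensionality; exact H).
subst y; f_equal; apply proof_irrelevance.
Qed.

Lemma d_ge0 (n : nat) : 0 <= d n.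
Proof. generalize (d_ge1 n); lra. Qed.

Lemma hahn_term_ge0 (u : nat -> C) (k : nat) :
  0 <= d k * Cmod (u (S k) - u k)%C.
Proof. apply Rmult_le_pos; [apply d_ge0 | apply Cmod_ge_0]. Qed.

Lemma hahn_term_plus (u v : nat -> C) (k : nat) :
  d k * Cmod ((u (S k) + v (S k)) - (u k + v k))%C <=
  d k * Cmod (u (S k) - u k)%C + d k * Cmod (v (S k) - v k)%C.
Proof.
rewrite <- Rmult_plus_distr_l; apply Rmult_le_compat_l; [apply d_ge0|].
replace ((u (S k) + v (S k)) - (u k + v k))%C
  with ((u (S k) - u k) + (v (S k) - v k))%C by ring.
apply Cmod_triangle.
Qed.

Lemma hahn_term_scal (a : C) (u : nat -> C) (k : nat) :
  d k * Cmod (a * u (S k) - a * u k)%C =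
  Cmod a * (d k * Cmod (u (S k) - u k)%C).
Proof.
replace (a * u (S k) - a * u k)%C with (a * (u (S k) - u k))%C by ring.
rewrite Cmod_mult; ring.
Qed.

Lemma is_lim_seq_0_le (u v : nat -> R) :
  (forall n, 0 <= u n <= v n) -> is_lim_seq v 0 -> is_lim_seq u 0.
Proof.
intros H Hv; apply is_lim_seq_le_le with (fun _ => 0) v; auto.
apply is_lim_seq_const.
Qed.

Program Definition hahn_zero : hd := Hahn (fun _ => 0%C) _ _.
Next Obligation.
apply is_lim_seq_ext with (fun _ => 0);
  [intros _; rewrite Cmod_0; auto | apply is_lim_seq_const].
Qed.
Next Obligation.
assert (Z : forall k, d k * Cmod (0 - 0)%C = 0)
  by (intros k; replace (0 - 0)%C with (RtoC 0) by ring; rewrite Cmod_0; ring).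
exists 0; refine (is_lim_seq_ext (fun _ => 0) _ 0 _ (is_lim_seq_const 0)).
induction n as [|n IH]; [rewrite sum_O, Z | rewrite sum_Sn, <- IH, Z]; auto.
symmetry; exact (Rplus_0_r 0).
Qed.

Program Definition hahn_plus (x y : hd) : hd :=
  Hahn (fun n => x n + y n)%C _ _.
Next Obligation.
apply is_lim_seq_0_le with (fun n => Cmod (x n) + Cmod (y n)).
- intros n; split; [apply Cmod_ge_0 | apply Cmod_triangle].
- replace (Finite 0) with (Finite (0 + 0)) by (f_equal; ring).
  apply is_lim_seq_plus'; apply hahn_null.
Qed.
Next Obligation.
apply (ex_series_le (K := R_AbsRing) (V := R_CompleteNormedModule)) with
  (b := fun k => d k * Cmod (x (S k) - x k)%C + d k * Cmod (y (S k) - y k)%C).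
- intros k; change (Rabs (d k * Cmod ((x (S k) + y (S k)) - (x k + y k))%C) <=
    d k * Cmod (x (S k) - x k)%C + d k * Cmod (y (S k) - y k)%C).
  rewrite Rabs_pos_eq; [apply hahn_term_plus|].
  apply (hahn_term_ge0 (fun n => (x n + y n)%C)).
- apply (ex_series_plus (V := R_NormedModule)); apply hahn_summable.
Qed.

Program Definition hahn_scal (a : C) (x : hd) : hd :=
  Hahn (fun n => a * x n)%C _ _.
Next Obligation.
apply is_lim_seq_ext with (fun n => Cmod a * Cmod (x n)).
- intros n; rewrite Cmod_mult; auto.
- replace (Finite 0) with (Rbar_mult (Cmod a) 0) by (simpl; f_equal; ring).
  apply is_lim_seq_scal_l, hahn_null.
Qed.
Next Obligation.
apply (ex_series_ext (V := R_NormedModule))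
  with (fun k => Cmod a * (d k * Cmod (x (S k) - x k)%C)).
- intros k; symmetry; apply hahn_term_scal.
- apply (ex_series_scal (V := R_NormedModule)), hahn_summable.
Qed.

Definition hahn_opp (x : hd) : hd := hahn_scal (-(1))%C x.

Definition hahn_AbelianMonoid_mixin : AbelianMonoid.mixin_of hd.
Proof.
apply (AbelianMonoid.Mixin hd hahn_plus hahn_zero);
  intros; apply hahn_eq; intros n; simpl; ring.
Defined.

Canonical hahn_AbelianMonoid : AbelianMonoid :=
  AbelianMonoid.Pack hd hahn_AbelianMonoid_mixin hd.

Definition hahn_AbelianGroup_mixin : AbelianGroup.mixin_of hahn_AbelianMonoid.
Proof.
apply (AbelianGroup.Mixin hahn_AbelianMonoid hahn_opp).
intros x; apply hahn_eq; intros n; simpl; ring.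
Defined.

Canonical hahn_AbelianGroup : AbelianGroup :=
  AbelianGroup.Pack hd
    (AbelianGroup.Class hd hahn_AbelianMonoid_mixin hahn_AbelianGroup_mixin)
    hd.

Definition hahn_ModuleSpace_mixin :
  ModuleSpace.mixin_of C_Ring hahn_AbelianGroup.
Proof.
apply (ModuleSpace.Mixin C_Ring hahn_AbelianGroup hahn_scal);
  intros; apply hahn_eq; intros n; simpl; unfold mult, plus, one; simpl; ring.
Defined.

Definition hahn_ModuleSpace_class : ModuleSpace.class_of C_Ring hd :=
  ModuleSpace.Class C_Ring hd (AbelianGroup.class hahn_AbelianGroup)
    hahn_ModuleSpace_mixin.

Canonical hahn_ModuleSpace : ModuleSpace C_Ring :=
  ModuleSpace.Pack C_Ring hd hahn_ModuleSpace_class hd.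

Lemma hahn_norm_plus (x y : hd) :
  hahn_norm (hahn_plus x y) <= hahn_norm x + hahn_norm y.
Proof.
unfold hahn_norm; rewrite <- Series_plus; try apply hahn_summable.
apply Series_le.
- intros k; split; [apply hahn_term_ge0 | apply hahn_term_plus].
- apply (ex_series_plus (V := R_NormedModule)); apply hahn_summable.
Qed.

Lemma hahn_norm_scal (a : C) (x : hd) :
  hahn_norm (hahn_scal a x) = Cmod a * hahn_norm x.
Proof.
unfold hahn_norm; rewrite <- Series_scal_l; apply Series_ext.
intros k; apply hahn_term_scal.
Qed.

Lemma hahn_norm_ge_sum (x : hd) (n : nat) :
  sum_n (fun k => d k * Cmod (x (S k) - x k)%C) n <= hahn_norm x.
Proof.
assert (H := Series_correct _ (hahn_summable x)).
apply (is_lim_seq_incr_compare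
  (sum_n (fun k => d k * Cmod (x (S k) - x k)%C))).
- exact H.
- intros m; rewrite sum_Sn; generalize (hahn_term_ge0 x (S m)).
  unfold plus; simpl; lra.
Qed.

Lemma sum_n_ge0 (a : nat -> R) (n : nat) :
  (forall k, 0 <= a k) -> 0 <= sum_n a n.
Proof.
intros Ha; induction n as [|n IH]; [rewrite sum_O; apply Ha|].
rewrite sum_Sn; generalize (Ha (S n)); unfold plus; simpl; lra.
Qed.

Lemma hahn_norm_ge0 (x : hd) : 0 <= hahn_norm x.
Proof.
apply Rle_trans with (2 := hahn_norm_ge_sum x 0), sum_n_ge0, hahn_term_ge0.
Qed.

Lemma hahn_sub_le_sum (u : nat -> C) (n m : nat) :
  Cmod (u n - u (n + m)%nat)%C +
    d (n + m)%nat * Cmod (u (S (n + m)) - u (n + m)%nat)%C <=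
  sum_n (fun k => d k * Cmod (u (S k) - u k)%C) (n + m).
Proof.
induction m as [|m IH].
- rewrite Nat.add_0_r; replace (u n - u n)%C with (RtoC 0) by ring.
  rewrite Cmod_0, Rplus_0_l; destruct n as [|n]; [rewrite sum_O; lra|].
  rewrite sum_Sn; unfold plus; simpl.
  generalize (sum_n_ge0 _ n (hahn_term_ge0 u)); lra.
- replace (n + S m)%nat with (S (n + m)) by lia; rewrite sum_Sn.
  set (p := (n + m)%nat) in *; unfold plus; simpl.
  assert (H1 : Cmod (u (S p) - u p)%C <= d p * Cmod (u (S p) - u p)%C).
  { rewrite <- (Rmult_1_l (Cmod _)) at 1.
    apply Rmult_le_compat_r; [apply Cmod_ge_0 | apply d_ge1]. }
  assert (H2 : Cmod (u n - u (S p))%C <=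
               Cmod (u n - u p)%C + Cmod (u (S p) - u p)%C).
  { rewrite <- (Cmod_opp (u (S p) - u p)%C).
    replace (u n - u (S p))%C with ((u n - u p) + - (u (S p) - u p))%C by ring.
    apply Cmod_triangle. }
  lra.
Qed.

Lemma hahn_norm_ge_coord (x : hd) (n : nat) : Cmod (x n) <= hahn_norm x.
Proof.
assert (H : forall m, Cmod (x n) <= hahn_norm x + Cmod (x (m + n)%nat)).
{ intros m; rewrite (Nat.add_comm m n).
  apply Rle_trans with (Cmod (x n - x (n + m)%nat)%C + Cmod (x (n + m)%nat)).
  - replace (x n) with ((x n - x (n + m)%nat) + x (n + m)%nat)%C at 1 by ring.
    apply Cmod_triangle.
  - generalize (hahn_sub_le_sum x n m) (hahn_norm_ge_sum x (n + m))
      (hahn_term_ge0 x (n + m)); lra. }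
assert (L : is_lim_seq (fun m => hahn_norm x + Cmod (x (m + n)%nat))
              (hahn_norm x + 0)).
{ apply is_lim_seq_plus'; [apply is_lim_seq_const|].
  apply (is_lim_seq_incr_n (fun m => Cmod (x m))), hahn_null. }
rewrite Rplus_0_r in L.
exact (is_lim_seq_le (fun _ => Cmod (x n)) _ _ _ H (is_lim_seq_const _) L).
Qed.

Definition hahn_ball (x : hd) (e : R) (y : hd) : Prop :=
  hahn_norm (minus y x) < e.

Lemma hahn_norm_zero : hahn_norm hahn_zero = 0.
Proof.
replace hahn_zero with (hahn_scal 0%C hahn_zero)
  by (apply hahn_eq; intros n; simpl; ring).
rewrite hahn_norm_scal, Cmod_0; ring.
Qed.

Lemma hahn_norm_opp (x : hd) : hahn_norm (hahn_opp x) = hahn_norm x.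
Proof.
unfold hahn_opp; rewrite hahn_norm_scal, Cmod_opp, Cmod_1; ring.
Qed.

Definition hahn_UniformSpace_mixin : UniformSpace.mixin_of hd.
Proof.
apply (UniformSpace.Mixin hd hahn_zero hahn_ball).
- intros x e; unfold hahn_ball; rewrite minus_eq_zero.
  change (hahn_norm hahn_zero < e); rewrite hahn_norm_zero; apply cond_pos.
- intros x y e; unfold hahn_ball; rewrite <- (opp_minus y x).
  change (hahn_norm (minus y x) < e -> hahn_norm (hahn_opp (minus y x)) < e).
  rewrite hahn_norm_opp; auto.
- intros x y z e1 e2; unfold hahn_ball; intros H1 H2.
  rewrite (minus_trans y z x).
  apply Rle_lt_trans with (1 := hahn_norm_plus _ _); lra.
Defined.

Canonical hahn_UniformSpace : UniformSpace :=
  UniformSpace.Pack hd hahn_UniformSpace_mixin hd.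

Definition hahn_NormedModuleAux_class : NormedModuleAux.class_of C_AbsRing hd :=
  NormedModuleAux.Class C_AbsRing hd hahn_ModuleSpace_class
    hahn_UniformSpace_mixin.

Canonical hahn_NormedModuleAux : NormedModuleAux C_AbsRing :=
  NormedModuleAux.Pack C_AbsRing hd hahn_NormedModuleAux_class hd.

Definition hahn_NormedModule_mixin :
  NormedModule.mixin_of C_AbsRing hahn_NormedModuleAux.
Proof.
apply (NormedModule.Mixin C_AbsRing hahn_NormedModuleAux hahn_norm 1).
- exact hahn_norm_plus.
- intros a x; apply Req_le, hahn_norm_scal.
- intros x y e H; exact H.
- intros x y e H; rewrite Rmult_1_l; exact H.
- intros x Hx; apply hahn_eq; intros n; apply Cmod_eq_0.
  apply Rle_antisym; [|apply Cmod_ge_0].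
  rewrite <- Hx; apply hahn_norm_ge_coord.
Defined.

Definition hahn_NormedModule_class : NormedModule.class_of C_AbsRing hd :=
  NormedModule.Class C_AbsRing hd hahn_NormedModuleAux_class
    hahn_NormedModule_mixin.

Canonical hahn_NormedModule : NormedModule C_AbsRing :=
  NormedModule.Pack C_AbsRing hd hahn_NormedModule_class hd.

Lemma hahn_diff_le (F : (hd -> Prop) -> Prop) (l : nat -> C) :
  ProperFilter F ->
  (forall n (e : posreal), F (fun x => Cmod (l n - x n)%C < e)) ->
  forall (e : posreal) x0, F (ball x0 e) ->
    (forall n, Cmod (l n - x0 n)%C <= e) /\
    (forall n, sum_n (fun k =>
       d k * Cmod ((l (S k) - x0 (S k)) - (l k - x0 k))%C) n <= e).
Proof.
intros FF Hl e x0 H0; split; intros N.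
- apply le_epsilon; intros r Hr.
  destruct (filter_ex _ (filter_and _ _ H0 (Hl N (mkposreal r Hr))))
    as [y [Hy1 Hy2]]; simpl in Hy2.
  replace (l N - x0 N)%C with ((y N - x0 N) + (l N - y N))%C by ring.
  apply Rle_trans with (1 := Cmod_triangle _ _), Rplus_le_compat; [|lra].
  apply Rle_trans with (hahn_norm (minus y x0)); [|left; exact Hy1].
  replace (y N - x0 N)%C with (minus y x0 N); [apply hahn_norm_ge_coord|].
  simpl; ring.
- apply le_epsilon; intros r Hr.
  assert (Hd : 0 < sum_n d N).
  { destruct N as [|N]; [rewrite sum_O | rewrite sum_Sn].
    - generalize (d_ge1 0); lra.
    - generalize (sum_n_ge0 d N d_ge0) (d_ge1 (S N)); unfold plus; simpl; lra. }
  assert (Hr' : 0 < r / (2 * sum_n d N)) by (apply Rdiv_lt_0_compat; lra).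
  set (r' := mkposreal _ Hr').
  assert (HN : forall m, F (fun y => forall k, (k <= m)%nat ->
                 Cmod (l k - y k)%C < r')).
  { induction m as [|m IH].
    - apply filter_imp with (2 := Hl 0%nat r'); intros y Hy k Hk.
      now replace k with 0%nat by lia.
    - apply filter_imp with (2 := filter_and _ _ IH (Hl (S m) r')).
      intros y [Hy1 Hy2] k Hk; destruct (Nat.eq_dec k (S m)) as [->|Hk'];
        [exact Hy2 | apply Hy1; lia]. }
  destruct (filter_ex _ (filter_and _ _ H0 (HN (S N)))) as [y [Hy1 Hy2]].
  apply Rle_trans with (hahn_norm (minus y x0) + r);
    [|apply Rplus_le_compat_r; left; exact Hy1].
  apply Rle_trans with (sum_n (fun k =>
      d k * Cmod (minus y x0 (S k) - minus y x0 k)%C) N +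
      2 * r' * sum_n d N).
  + clear H0 Hl HN Hy1 Hd; clearbody r'; clear Hr'; simpl.
    assert (T : forall k, (k <= N)%nat ->
      d k * Cmod ((l (S k) - x0 (S k)) - (l k - x0 k))%C <=
      d k * Cmod ((y (S k) + -(1) * x0 (S k)) - (y k + -(1) * x0 k))%C +
      2 * r' * d k).
    { intros k Hk; rewrite (Rmult_comm (2 * r')), <- Rmult_plus_distr_l.
      apply Rmult_le_compat_l; [apply d_ge0|].
      assert (K1 : Cmod (l (S k) - y (S k))%C < r') by (apply Hy2; lia).
      assert (K2 : Cmod (l k - y k)%C < r') by (apply Hy2; lia).
      replace ((l (S k) - x0 (S k)) - (l k - x0 k))%C with
        (((y (S k) + -(1) * x0 (S k)) - (y k + -(1) * x0 k)) +
         ((l (S k) - y (S k)) + - (l k - y k)))%C by ring.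
      apply Rle_trans with (1 := Cmod_triangle _ _), Rplus_le_compat_l.
      apply Rle_trans with (1 := Cmod_triangle _ _); rewrite Cmod_opp; lra. }
    clear Hy2; induction N as [|N IH].
    * rewrite !sum_O; apply T; lia.
    * rewrite !sum_Sn; unfold plus; simpl.
      assert (IH' := IH (fun k Hk => T k (Nat.le_trans _ _ _ Hk (Nat.le_succ_diag_r N)))).
      assert (T' := T (S N) (Nat.le_refl _)); simpl in T'.
      lra.
  + apply Rplus_le_compat; [apply hahn_norm_ge_sum|].
    unfold r'; simpl; apply Req_le; field; lra.
Qed.

Lemma hahn_complete (F : (hd -> Prop) -> Prop) :
  exists l : hd, ProperFilter F -> cauchy F ->
    forall e : posreal, F (ball l e).
Proof.
destruct (Classical_Prop.classic (ProperFilter F /\ cauchy F)) as [[FF CF]|N];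
  [|exists hahn_zero; tauto].
assert (HG : exists l : nat -> C, forall n (e : posreal),
               F (fun x => Cmod (l n - x n)%C < e)).
{ pose (G n := filtermap (fun x : hd => x n) F).
  assert (FG : forall n, ProperFilter (G n))
    by (intros n; apply filtermap_proper_filter, FF).
  exists (fun n => lim (T := C_CompleteNormedModule) (G n)); intros n e.
  assert (CG : cauchy (T := C_UniformSpace) (G n)).
  { intros r; destruct (CF r) as [x Hx]; exists (x n).
    apply filter_imp with (2 := Hx); intros y Hy.
    apply C_NormedModule_mixin_compat1.
    apply Rle_lt_trans with (2 := Hy).
    replace (minus (y n) (x n)) with (minus y x n);
      [exact (hahn_norm_ge_coord (minus y x) n)|].
    unfold minus, plus, opp; simpl; ring. }
  assert (H := complete_cauchy (T := C_CompleteNormedModule) (G n) (FG n) CG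
                 (pos_div_2 e)).
  change (F (fun x : hd => ball (lim (T := C_CompleteNormedModule) (G n))
                             (pos_div_2 e) (x n))) in H.
  apply filter_imp with (2 := H); intros y Hy.
  assert (Hy' := C_NormedModule_mixin_compat2 _ _ (pos_div_2 e) Hy).
  rewrite <- Cmod_opp, Copp_minus_distr.
  apply Rlt_le_trans with (1 := Hy'); simpl.
  assert (sqrt 2 <= 2); [|generalize (cond_pos e); nra].
  rewrite <- (sqrt_Rsqr 2) at 2 by lra; apply sqrt_le_1_alt; unfold Rsqr; lra. }
destruct HG as [l Hl].
assert (HF := hahn_diff_le F l FF Hl).
assert (Hnull : is_lim_seq (fun n => Cmod (l n)) 0).
{ apply is_lim_seq_spec; intros e; simpl.
  destruct (CF (pos_div_2 e)) as [x0 H0].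
  destruct (HF _ _ H0) as [H1 _]; simpl in H1.
  generalize (hahn_null x0); intros L; apply is_lim_seq_spec in L.
  apply filter_imp with (2 := L (pos_div_2 e)); simpl; intros n Hn.
  rewrite Rminus_0_r, Rabs_pos_eq in * by apply Cmod_ge_0.
  replace (l n) with (x0 n + (l n - x0 n))%C by ring.
  apply Rle_lt_trans with (1 := Cmod_triangle _ _).
  generalize (H1 n); lra. }
assert (Hsum : ex_series (fun k => d k * Cmod (l (S k) - l k)%C)).
{ destruct (CF (mkposreal 1 Rlt_0_1)) as [x0 H0].
  destruct (HF _ _ H0) as [_ H1]; simpl in H1.
  apply (ex_series_le (K := R_AbsRing) (V := R_CompleteNormedModule)) with
    (b := fun k => d k * Cmod (x0 (S k) - x0 k)%C +
      d k * Cmod ((l (S k) - x0 (S k)) - (l k - x0 k))%C).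
  - intros k; change (Rabs (d k * Cmod (l (S k) - l k)%C) <=
      d k * Cmod (x0 (S k) - x0 k)%C +
      d k * Cmod ((l (S k) - x0 (S k)) - (l k - x0 k))%C).
    rewrite Rabs_pos_eq by apply hahn_term_ge0.
    generalize (hahn_term_plus x0 (fun n => l n - x0 n)%C k).
    replace ((x0 (S k) + (l (S k) - x0 (S k))) - (x0 k + (l k - x0 k)))%C
      with (l (S k) - l k)%C by ring; auto.
  - apply (ex_series_plus (V := R_NormedModule)); [apply hahn_summable|].
    destruct (ex_finite_lim_seq_incr (sum_n (fun k =>
        d k * Cmod ((l (S k) - x0 (S k)) - (l k - x0 k))%C)) 1) as [s Hs].
    + intros n; rewrite sum_Sn; unfold plus; simpl.
      generalize (hahn_term_ge0 (fun n => l n - x0 n)%C (S n)); lra.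
    + exact H1.
    + exists s; exact Hs. }
exists (Hahn l Hnull Hsum); intros _ _ e.
destruct (CF (mkposreal _ (is_pos_div_2 (pos_div_2 e)))) as [x0 H0].
destruct (HF _ _ H0) as [_ H1].
apply filter_imp with (2 := H0); intros y Hy.
replace (pos e) with (e / 2 + e / 2) by field.
apply ball_triangle with x0.
- apply ball_sym; unfold ball; simpl; unfold hahn_ball.
  apply Rle_lt_trans with (e / 2 / 2);
    [|generalize (cond_pos e); lra].
  assert (Hs := Series_correct _ (hahn_summable (minus (Hahn l Hnull Hsum) x0))).
  refine (is_lim_seq_le (sum_n _) (fun _ => e / 2 / 2) (Finite (Series _))
            (Finite (e / 2 / 2)) _ Hs (is_lim_seq_const _)).
  intros n; apply Rle_trans with (2 := H1 n), Req_le, sum_n_ext; intros k.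
  simpl; do 2 f_equal; ring.
- apply Rlt_trans with (1 := Hy); simpl; generalize (cond_pos e); lra.
Qed.

Definition hahn_lim (F : (hd -> Prop) -> Prop) : hd :=
  proj1_sig (constructive_indefinite_description _ (hahn_complete F)).

Definition hahn_CompleteSpace_mixin : CompleteSpace.mixin_of hahn_UniformSpace.
Proof.
apply (CompleteSpace.Mixin hahn_UniformSpace hahn_lim).
- intros F; exact (proj2_sig (constructive_indefinite_description _ (hahn_complete F))).
- intros F1 F2 H1 H2.
  assert (E : F1 = F2).
  { apply functional_extensionality; intros P; apply propositional_extensionality.
    split; [apply H2 | apply H1]. }
  rewrite E; apply close_refl.
Defined.

Canonical hahn_CompleteNormedModule : CompleteNormedModule C_AbsRing :=
  CompleteNormedModule.Pack C_AbsRing hd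
    (CompleteNormedModule.Class C_AbsRing hd hahn_NormedModule_class
      hahn_CompleteSpace_mixin) hd.

End HahnSpace.

Arguments hahn_norm {d d_ge1} x.
Arguments hahn_eq {d d_ge1} x y _.

(* [is_linear] is Coquelicot's predicate "linear and bounded", so
   [is_linear T] for [T : X -> X] means that T belongs to L(X). *)
Section Operators.

Context {X : NormedModule C_AbsRing}.

Implicit Types (T S P : X -> X) (A B : X -> Prop) (lambda : C).

Definition closure A (x : X) : Prop :=
  forall P : X -> Prop, locally x P -> exists y, A y /\ P y.

Definition compact_set A : Prop :=
  forall (I : Type) (O : I -> X -> Prop),
    (forall i, open (O i)) ->
    (forall x, A x -> exists i, O i x) ->
    exists l : list I, forall x, A x -> exists i, In i l /\ O i x.

Definition bounded_set B : Prop :=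
  exists M : R, forall x, B x -> norm x <= M.

Definition image T B (y : X) : Prop := exists x, B x /\ y = T x.

Definition compact_operator T : Prop :=
  is_linear T /\
  forall B, bounded_set B -> compact_set (closure (image T B)).

Definition point_spectrum T lambda : Prop :=
  exists x : X, x <> zero /\ T x = scal lambda x.

Definition resolvent_set T lambda : Prop :=
  exists S, is_linear S /\
    (forall x, S (minus (scal lambda x) (T x)) = x) /\
    (forall x, minus (scal lambda (S x)) (T (S x)) = x).

Definition spectrum T lambda : Prop := ~ resolvent_set T lambda.

(* Valued in [Rbar], hence equal to [p_infty] when T is unbounded. *)
Definition op_norm T : Rbar :=
  Lub_Rbar (fun r => exists x : X, norm x <= 1 /\ r = norm (T x)).

Definition power T (n : nat) (x : X) : X := Nat.iter n T x.

Definition cesaro_mean T (n : nat) (x : X) : X :=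
  scal (RtoC (/ INR n)) (sum_n_m (fun m => power T m x) 1 n).

Definition power_bounded T : Prop :=
  exists M : R, forall n : nat, (1 <= n)%nat -> Rbar_le (op_norm (power T n)) M.

Definition uniformly_mean_ergodic T : Prop :=
  exists P, is_linear P /\
    forall eps : posreal, exists N : nat, forall n : nat,
      (1 <= n)%nat -> (N <= n)%nat ->
      Rbar_lt (op_norm (fun x => minus (cesaro_mean T n x) (P x))) eps.

Definition dense A : Prop := forall x : X, closure A x.

Definition supercyclic T : Prop :=
  exists x : X,
    dense (fun y => exists lambda (n : nat), y = scal lambda (power T n x)).

End Operators.

(* [t ^ 0 = 1] also for [t = 0]. *)
Definition cesaro (t : R) (x : nat -> C) (n : nat) : C :=
  (sum_n (fun k => RtoC (t ^ (n - k)) * x k)%C n / RtoC (INR n + 1))%C.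

Definition Lambda (z : C) : Prop := exists n : nat, z = RtoC (/ (INR n + 1)).

Definition Lambda0 (z : C) : Prop := Lambda z \/ z = RtoC 0.

(* Main.v *)
(* The matrix of C_t is lower triangular with diagonal 1/(n+1), and
   v_N(n) = t^(n-N) binomial(n, N) is an eigenvector for 1/(N+1) which lies in
   h_d by the ratio test.  The norm of C_t on the invariant subspace
   h^N = {x : x_0 = ... = x_{N-1} = 0} tends to 0 as N grows, because d_{k+1}/d_k -> 1
   makes t d_{k+1}/d_k <= q < 1 eventually.  Since h^N is spanned by v_N and
   h^(N+1), any statement that holds on h^N for large N descends to h^0 or h^1
   one dimension at a time: boundedness of C_t, solvability of
   (lambda - C_t) x = y for lambda outside Lambda_0 (a Neumann series for
   large N), and |C_t^n x| <= M 2^(-n) |x| on h^1.  The last bound gives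
   C_t^n x = x_0 v_0 + O(2^(-n)), hence power boundedness and uniform mean
   ergodicity.  Compactness follows by truncation, and 0 is in the spectrum
   because C_t is not bounded below. *)

Require Import Defs.
From Stdlib Require Import Reals Arith Lra Lia List Classical IndefiniteDescription.
From Coquelicot Require Import Coquelicot.

Open Scope R_scope.

(** The descent scheme: an estimate obtained on h^N for some large N is carried down one dimension
    at a time. *)
Lemma nat_downward_ind (P : nat -> Prop) (N : nat) :
  P N -> (forall n, P (S n) -> P n) -> P 0%nat.
Proof. intros HN HS; induction N as [|N IH]; auto. Qed.

Lemma minus_plus_plus {G : AbelianGroup} (a b c e : G) :
  minus (plus a b) (plus c e) = plus (minus a c) (minus b e).
Proof.
unfold minus; rewrite opp_plus, <- !plus_assoc; f_equal.
rewrite !plus_assoc; f_equal; apply plus_comm.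
Qed.

(** * Compactness and Neumann series *)

Section TotallyBounded.

Context {X : NormedModule C_AbsRing}.

Definition totally_bounded (A : X -> Prop) : Prop :=
  forall e : posreal, exists l : list X,
    forall x, A x -> exists c, In c l /\ norm (minus x c) < e.

Lemma totally_bounded_plus (A B : X -> Prop) :
  totally_bounded A -> totally_bounded B ->
  totally_bounded (fun z => exists a b, A a /\ B b /\ z = plus a b).
Proof.
intros HA HB e.
destruct (HA (pos_div_2 e)) as [l Hl], (HB (pos_div_2 e)) as [m Hm].
exists (map (fun p => plus (fst p) (snd p)) (list_prod l m)).
intros z (a & b & Ha & Hb & ->).
destruct (Hl a Ha) as [c [Hc1 Hc2]], (Hm b Hb) as [c' [Hd1 Hd2]].
exists (plus c c'); split.
- apply (in_map (fun p => plus (fst p) (snd p)) _ (c, c')), in_prod; auto.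
- replace (minus (plus a b) (plus c c')) with (plus (minus a c) (minus b c')).
  + apply Rle_lt_trans with (1 := norm_triangle _ _); simpl in *; lra.
  + symmetry; apply (minus_plus_plus (G := X)).
Qed.

(** A finite e/2-net of a set that approximates [A] within e/2 is an e-net of [A]. *)
Lemma totally_bounded_approx (A : X -> Prop) :
  (forall e : posreal, exists A', totally_bounded A' /\
     forall x, A x -> exists y, A' y /\ norm (minus x y) <= e) ->
  totally_bounded A.
Proof.
intros H e; destruct (H (pos_div_2 e)) as (A' & HA' & HAA').
destruct (HA' (pos_div_2 e)) as [l Hl]; exists l; intros x Hx.
destruct (HAA' x Hx) as (y & Hy & Hxy), (Hl y Hy) as (c & Hc & Hyc).
exists c; split; auto.
rewrite (minus_trans y).
apply Rle_lt_trans with (1 := norm_triangle _ _); simpl in *; lra.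
Qed.

Lemma totally_bounded_real_segment (M : R) (v : X) :
  totally_bounded (fun z => exists r, Rabs r <= M /\ z = scal (RtoC r) v).
Proof.
intros e.
(* Mesh width: moving the coefficient by at most [h] moves the point by at most [h * norm v < e].
   The added 1 covers the case [v = zero]. *)
set (h := e / (norm v + 1)).
assert (Hv := norm_ge_0 v).
assert (Hh : 0 < h) by (apply Rdiv_lt_0_compat; [apply cond_pos | lra]).
set (c := fun k => scal (RtoC (- M + INR k * h)) v).
destruct (Rlt_or_le M 0) as [HM|HM].
{ exists nil; intros x (r & Hr & _); generalize (Rabs_pos r); lra. }
destruct (nfloor_ex (2 * M / h)) as [n [_ Hn]].
{ apply Rdiv_le_0_compat; lra. }
exists (map c (seq 0 (S n))); intros z (r & Hr & ->).
apply Rabs_le_between in Hr.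
destruct (nfloor_ex ((r + M) / h)) as [k [Hk1 Hk2]].
{ apply Rdiv_le_0_compat; lra. }
exists (c k); split.
- apply in_map, in_seq; split; [lia|]; apply INR_lt; rewrite Nat.add_0_l, S_INR.
  apply Rle_lt_trans with (1 := Hk1), Rle_lt_trans with (2 := Hn).
  apply Rmult_le_compat_r; [apply Rlt_le, Rinv_0_lt_compat; lra | lra].
- apply Rle_lt_trans with (norm (scal (minus (RtoC r) (RtoC (- M + INR k * h))) v)).
  { right; f_equal; symmetry; apply (scal_minus_distr_r (V := X)). }
  apply Rle_lt_trans with (1 := norm_scal (K := C_AbsRing) (V := X) _ _).
  change (Cmod (RtoC r - RtoC (- M + INR k * h))%C * norm v < e).
  rewrite <- RtoC_minus, Cmod_R, Rabs_pos_eq.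
  + apply Rle_lt_trans with (h * norm v).
    * apply Rmult_le_compat_r; auto.
      replace r with ((r + M) / h * h - M) by (field; lra); nra.
    * replace (pos e) with (h * (norm v + 1)) by (unfold h; field; lra); nra.
  + replace r with ((r + M) / h * h - M) by (field; lra); nra.
Qed.

(** Splitting the coefficient into real and imaginary parts places the disc inside the sum of two
    real segments, along v and along iv. *)
Lemma totally_bounded_disc (M : R) (v : X) :
  totally_bounded (fun z => exists a, Cmod a <= M /\ z = scal a v).
Proof.
intros e.
destruct (totally_bounded_plus _ _ (totally_bounded_real_segment M v)
  (totally_bounded_real_segment M (scal Ci v)) e) as [l Hl].
exists l; intros z (a & Ha & ->); apply Hl.
exists (scal (RtoC (fst a)) v), (scal (RtoC (snd a)) (scal Ci v)).
assert (H := Rmax_Cmod a).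
split; [|split].
- exists (fst a); split; auto.
  apply Rle_trans with (2 := Ha), Rle_trans with (2 := H), Rmax_l.
- exists (snd a); split; auto.
  apply Rle_trans with (2 := Ha), Rle_trans with (2 := H), Rmax_r.
- transitivity (scal (plus (RtoC (fst a)) (mult (RtoC (snd a)) Ci)) v).
  2: { rewrite (scal_distr_r (V := X)); f_equal.
       symmetry; apply (scal_assoc (V := X)). }
  f_equal; change (a = RtoC (fst a) + RtoC (snd a) * Ci)%C.
  destruct a as [x y]; unfold Cplus, Cmult, Ci, RtoC; simpl; f_equal; ring.
Qed.

End TotallyBounded.

Section Complete.

Context {X : CompleteNormedModule C_AbsRing}.

Lemma closure_closure (A : X -> Prop) (x : X) :
  closure (closure A) x -> closure A x.
Proof.
intros H P HP.
destruct (H _ (locally_locally x P HP)) as (y & Hy & HyP); exact (Hy P HyP).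
Qed.

(* If no finite subfamily covered the closure K, intersecting K successively
   with members of its nets would give a decreasing sequence of sets that are
   not finitely covered and generate a Cauchy filter; but an open set of the
   cover around the limit of this filter contains one of them. *)
Lemma totally_bounded_compact_closure (A : X -> Prop) :
  totally_bounded A -> compact_set (closure A).
Proof.
intros TB I O HO Hcov.
set (K := closure A).
set (fc := fun B : X -> Prop => exists l : list I,
  forall x, B x -> exists i, In i l /\ O i x).
change (fc K); apply NNPP; intros HK.
(* If [B] is not finitely covered, neither is its trace on some ball of radius 1/(n+1). Quantifying
   over all pairs (B, n) lets choice produce a single function to recurse with. *)
assert (Hsplit : forall p : (X -> Prop) * nat, exists c : X,
  (forall x, fst p x -> K x) -> ~ fc (fst p) ->
  ~ fc (fun x => fst p x /\ ball c (/ (INR (snd p) + 1)) x)).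
{ intros [B n]; simpl; assert (Hn := RinvN_pos n); set (r := mkposreal _ Hn).
  apply NNPP; intros Hno; destruct (TB (pos_div_2 r)) as [l Hl].
  assert (HB : (forall x, B x -> K x) /\ ~ fc B).
  (* When the premises fail, any centre serves; [zero] is a default. *)
  { apply NNPP; intros HB; apply Hno; exists zero; intros; exfalso; apply HB; auto. }
  destruct HB as [HBK HB]; apply HB.
  assert (Hfc : forall c, fc (fun x => B x /\ ball c r x)).
  { intros c; apply NNPP; intros Hc; apply Hno; exists c; auto. }
  assert (Hlist : forall m : list X,
    fc (fun x => B x /\ exists c, In c m /\ ball c r x)).
  { induction m as [|c m [s Hs]]; [exists nil; intros x (_ & c & [] & _)|].
    destruct (Hfc c) as [s' Hs']; exists (s' ++ s).
    intros x (Hx & c' & [<-|Hc'] & Hb).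
    - destruct (Hs' x (conj Hx Hb)) as (i & Hi & Hxi); exists i; split; auto.
      apply in_or_app; auto.
    - destruct (Hs x) as (i & Hi & Hxi); [split; eauto|].
      exists i; split; auto; apply in_or_app; auto. }
  destruct (Hlist l) as [s Hs]; exists s; intros x Hx; apply Hs; split; auto.
  (* The net is one for [A] while x is only in its closure, so half of the radius is spent on
     reaching a point of [A]. *)
  destruct (HBK x Hx (ball x (pos_div_2 r)) (locally_ball x (pos_div_2 r)))
    as (y & Hy & Hxy).
  destruct (Hl y Hy) as (c & Hc & Hyc); exists c; split; auto.
  replace (pos r) with (pos_div_2 r + pos_div_2 r) by (simpl; lra).
  apply ball_triangle with y; [apply (norm_compat1 (V := X)) | apply ball_sym]; auto. }
apply functional_choice in Hsplit; destruct Hsplit as [f Hf].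
set (B := fix B n : X -> Prop := match n with
  | O => K
  | S n => fun x => B n x /\ ball (f (B n, n)) (/ (INR n + 1)) x end).
assert (HBK : forall n x, B n x -> K x).
{ induction n as [|n IH]; simpl; intros x; [auto|]; intros [Hx _]; auto. }
assert (HB : forall n, ~ fc (B n)).
{ induction n as [|n IH]; auto; apply (Hf (B n, n)); auto; apply HBK. }
assert (Hmono : forall n m x, B (n + m)%nat x -> B n x).
{ intros n m x; induction m as [|m IH]; [rewrite Nat.add_0_r; auto|].
  replace (n + S m)%nat with (S (n + m)) by lia; intros [Hx _]; auto. }
set (F := fun P : X -> Prop => exists n, forall x, B n x -> P x).
assert (FF : ProperFilter F).
{ split; [|split].
  - intros P [n Hn]; apply NNPP; intros HP; apply (HB n); exists nil.
    intros x Hx; exfalso; apply HP; exists x; auto.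
  - exists 0%nat; auto.
  - intros P Q [n Hn] [m Hm]; exists (n + m)%nat; intros x Hx; split.
    + apply Hn, Hmono with m, Hx.
    + apply Hm, Hmono with n; rewrite Nat.add_comm; apply Hx.
  - intros P Q HPQ [n Hn]; exists n; auto. }
assert (FC : cauchy F).
{ intros e; destruct (nfloor_ex (/ e)) as [n [_ Hn]].
  { apply Rlt_le, Rinv_0_lt_compat, cond_pos. }
  exists (f (B n, n)), (S n); intros x [_ Hx].
  apply ball_le with (2 := Hx); rewrite <- (Rinv_inv e).
  apply Rinv_le_contravar; [apply Rinv_0_lt_compat, cond_pos | lra]. }
assert (Hlim := complete_cauchy F FF FC).
assert (HKl : K (lim F)).
{ apply closure_closure; intros P [e He].
  destruct (Hlim e) as [n Hn].
  destruct (filter_ex (F := F) (B n)) as [x Hx]; [exists n; auto|].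
  exists x; split; [apply (HBK n) | apply He, Hn]; auto. }
destruct (Hcov _ HKl) as [i Hi], (HO i _ Hi) as [e He], (Hlim e) as [n Hn].
apply (HB n); exists (i :: nil); intros x Hx; exists i; split; [left; auto|].
apply He, Hn, Hx.
Qed.

Lemma power_contraction (A : X -> X) (q : R) :
  0 <= q -> (forall x, norm (A x) <= q * norm x) ->
  forall n x, norm (power A n x) <= q ^ n * norm x.
Proof.
intros Hq HA n x; induction n as [|n IH]; [simpl; lra|].
apply Rle_trans with (1 := HA _); simpl; rewrite Rmult_assoc.
apply Rmult_le_compat_l; auto.
Qed.

(** The solution is the Neumann series of the [A]^n y, which converges by completeness. Its partial
    sums satisfy s_{n+1} = y + A s_n, and continuity of [A] passes this to the limit. *)
Lemma contraction_id_minus_onto (A : X -> X) (q : R) :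
  is_linear A -> 0 <= q < 1 -> (forall x, norm (A x) <= q * norm x) ->
  forall y, exists x, x = plus y (A x).
Proof.
intros LA Hq HA y.
set (a := fun n => power A n y).
assert (Ea : ex_series a).
{ apply ex_series_le with (fun n => q ^ n * norm y).
  - intros n; apply power_contraction; auto; apply Hq.
  - apply ex_series_scal_r, ex_series_geom; rewrite Rabs_pos_eq; apply Hq. }
destruct Ea as [x Hx]; exists x.
assert (Esum : forall n, sum_n a (S n) = plus y (A (sum_n a n))).
{ induction n as [|n IH].
  - rewrite sum_Sn, !sum_O; reflexivity.
  - transitivity (plus (sum_n a (S n)) (a (S (S n)))).
    { apply (sum_Sn (G := X)). }
    transitivity (plus (plus y (A (sum_n a n))) (a (S (S n)))).
    { f_equal; exact IH. }
    transitivity (plus y (A (plus (sum_n a n) (a (S n))))).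
    2: { apply (f_equal (fun z => plus y (A z))).
         symmetry; apply (sum_Sn (G := X)). }
    transitivity (plus y (plus (A (sum_n a n)) (a (S (S n))))).
    + symmetry; apply (plus_assoc (G := X)).
    + apply (f_equal (plus y)); symmetry; apply (linear_plus _ LA). }
assert (Hx1 : filterlim (fun n => sum_n a (S n)) eventually (locally x)).
{ apply filterlim_comp with (2 := Hx).
  intros P [N HN]; exists N; intros n Hn; apply HN; lia. }
apply (filterlim_locally_unique _ _ _ Hx1).
apply filterlim_ext with (fun n => plus y (A (sum_n a n))).
- intros n; symmetry; apply Esum.
- apply (filterlim_comp_2 (F := eventually) (G := locally y) (H := locally (A x))
    (fun _ => y) (fun n => A (sum_n a n)) plus).
  + apply filterlim_const.
  + apply filterlim_comp with (1 := Hx); exact (linear_cont A x LA).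
  + apply (filterlim_plus (V := X)).
Qed.

End Complete.

(** * Operator norms and powers of operators *)

Section OperatorNorm.

Context {X : NormedModule C_AbsRing}.

Lemma op_norm_le (T : X -> X) (M : R) :
  0 <= M -> (forall x, norm (T x) <= M * norm x) -> Rbar_le (op_norm T) M.
Proof.
intros HM HT; apply Lub_Rbar_correct; intros r (x & Hx & ->); simpl.
apply Rle_trans with (1 := HT x); generalize (norm_ge_0 x); nra.
Qed.

Lemma power_linear (T : X -> X) (n : nat) : is_linear T -> is_linear (power T n).
Proof.
intros LT; induction n as [|n IH]; [exact is_linear_id|].
exact (is_linear_comp _ _ IH LT).
Qed.

Lemma power_eigenvector (T : X -> X) (r : R) (v : X) (n : nat) :
  is_linear T -> T v = scal (RtoC r) v -> power T n v = scal (RtoC (r ^ n)) v.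
Proof.
intros LT Ev; induction n as [|n IH].
- symmetry; apply (scal_one (V := X)).
- transitivity (T (scal (RtoC (r ^ n)) v)); [exact (f_equal T IH)|].
  transitivity (scal (RtoC (r ^ n)) (T v)); [apply (linear_scal _ LT)|].
  rewrite Ev; simpl; rewrite Rmult_comm, RtoC_mult; apply (scal_assoc (V := X)).
Qed.

End OperatorNorm.

(** * The Cesaro matrix and its eigenvectors *)

Lemma ex_series_ratio (a : nat -> R) (q : R) (K : nat) :
  (forall k, 0 <= a k) -> 0 <= q < 1 ->
  (forall k, (K <= k)%nat -> a (S k) <= q * a k) -> ex_series a.
Proof.
intros Ha Hq HK; apply (ex_series_incr_n a K).
assert (H : forall k, a (K + k)%nat <= q ^ k * a K).
{ induction k as [|k IH]; [rewrite Nat.add_0_r; simpl; lra|].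
  rewrite Nat.add_succ_r; apply Rle_trans with (1 := HK _ (Nat.le_add_r K k)).
  simpl; rewrite Rmult_assoc; apply Rmult_le_compat_l; [apply Hq | exact IH]. }
apply (ex_series_le (K := R_AbsRing) (V := R_CompleteNormedModule))
  with (fun k => q ^ k * a K).
- intros k; change (Rabs (a (K + k)%nat) <= q ^ k * a K).
  rewrite Rabs_pos_eq; auto.
- apply ex_series_scal_r, ex_series_geom; rewrite Rabs_pos_eq; apply Hq.
Qed.

Lemma sum_n_mono (a : nat -> R) (n m : nat) :
  (forall k, 0 <= a k) -> (n <= m)%nat -> sum_n a n <= sum_n a m.
Proof.
intros Ha; induction 1 as [|m _ IH]; [lra|].
rewrite sum_Sn; unfold plus; simpl; generalize (Ha (S m)); lra.
Qed.

(** The condition that cuts out the invariant subspace h^N. *)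
Definition vanishes_below (N : nat) (u : nat -> C) : Prop :=
  forall n, (n < N)%nat -> u n = 0%C.

(** The numerator of the Cesàro mean, isolated because it obeys the two-term recursion s_{n+1} = t
    s_n + u_{n+1}. *)
Definition cesaro_sum (t : R) (u : nat -> C) (n : nat) : C :=
  sum_n (fun k => RtoC (t ^ (n - k)) * u k)%C n.

Lemma cesaro_sum_0 (t : R) (u : nat -> C) : cesaro_sum t u 0 = u 0%nat.
Proof. unfold cesaro_sum; rewrite sum_O; simpl; ring. Qed.

Lemma cesaro_sum_S (t : R) (u : nat -> C) (n : nat) :
  cesaro_sum t u (S n) = (RtoC t * cesaro_sum t u n + u (S n))%C.
Proof.
unfold cesaro_sum; rewrite sum_Sn, Nat.sub_diag.
rewrite <- (sum_n_mult_l (K := C_Ring)).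
rewrite (sum_n_ext_loc _
  (fun k => mult (K := C_Ring) (RtoC t) (RtoC (t ^ (n - k)) * u k)%C)).
- change plus with Cplus; f_equal; simpl; ring.
- intros k Hk; rewrite Nat.sub_succ_l by exact Hk; simpl.
  change mult with Cmult; rewrite RtoC_mult; ring.
Qed.

Lemma cesaro_sum_vanishes (t : R) (u : nat -> C) (N : nat) :
  vanishes_below N u -> vanishes_below N (cesaro_sum t u).
Proof.
intros Hu n; induction n as [|n IH]; intros Hn.
- rewrite cesaro_sum_0; apply Hu, Hn.
- rewrite cesaro_sum_S, IH, Hu by lia; ring.
Qed.

Lemma INR1_neq0 (n : nat) : RtoC (INR n + 1) <> 0%C.
Proof. intros H; apply RtoC_inj in H; generalize (pos_INR n); lra. Qed.

Lemma cesaro_vanishes (t : R) (u : nat -> C) (N : nat) :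
  vanishes_below N u -> vanishes_below N (cesaro t u).
Proof.
intros Hu n Hn; unfold cesaro; fold (cesaro_sum t u n).
rewrite (cesaro_sum_vanishes t u N Hu n Hn); unfold Cdiv; ring.
Qed.

Lemma cesaro_diag (t : R) (u : nat -> C) (N : nat) :
  vanishes_below N u -> cesaro t u N = (RtoC (/ (INR N + 1)) * u N)%C.
Proof.
intros Hu; unfold cesaro; fold (cesaro_sum t u N).
assert (E : cesaro_sum t u N = u N).
{ destruct N as [|N]; [apply cesaro_sum_0|].
  rewrite cesaro_sum_S, (cesaro_sum_vanishes t u (S N) Hu N) by lia; ring. }
rewrite E, RtoC_inv by (generalize (pos_INR N); lra); unfold Cdiv; ring.
Qed.

Lemma cesaro_ext (t : R) (u v : nat -> C) (n : nat) :
  (forall k, u k = v k) -> cesaro t u n = cesaro t v n.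
Proof.
intros H; unfold cesaro; f_equal; apply sum_n_ext; intros k; rewrite H; auto.
Qed.

Lemma cesaro_plus (t : R) (u v : nat -> C) (n : nat) :
  cesaro t (fun k => u k + v k)%C n = (cesaro t u n + cesaro t v n)%C.
Proof.
unfold cesaro, Cdiv; rewrite <- Cmult_plus_distr_r; f_equal.
rewrite <- (sum_n_plus (G := C_AbelianMonoid)); apply sum_n_ext; intros k.
change (RtoC (t ^ (n - k)) * (u k + v k) =
  RtoC (t ^ (n - k)) * u k + RtoC (t ^ (n - k)) * v k)%C; ring.
Qed.

Lemma cesaro_scal (t : R) (a : C) (u : nat -> C) (n : nat) :
  cesaro t (fun k => a * u k)%C n = (a * cesaro t u n)%C.
Proof.
unfold cesaro, Cdiv; rewrite Cmult_assoc; f_equal.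
rewrite <- (sum_n_mult_l (K := C_Ring)); apply sum_n_ext; intros k.
change (RtoC (t ^ (n - k)) * (a * u k) = a * (RtoC (t ^ (n - k)) * u k))%C; ring.
Qed.

(* For n >= N the value is t^(n-N) * binomial(n, N). *)
Fixpoint eigenvector (t : R) (N n : nat) : R :=
  match n with
  | O => if Nat.eq_dec N 0 then 1 else 0
  | S n => if Nat.eq_dec (S n) N then 1
           else t * (INR n + 1) / (INR n + 1 - INR N) * eigenvector t N n
  end.

Lemma eigenvector_succ (t : R) (N n : nat) :
  eigenvector t N (S n) = if Nat.eq_dec (S n) N then 1
    else t * (INR n + 1) / (INR n + 1 - INR N) * eigenvector t N n.
Proof. reflexivity. Qed.

Lemma eigenvector_below (t : R) (N n : nat) :
  (n < N)%nat -> eigenvector t N n = 0.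
Proof.
induction n as [|n IH]; intros Hn.
- simpl; destruct (Nat.eq_dec N 0); [lia | auto].
- rewrite eigenvector_succ; destruct (Nat.eq_dec (S n) N); [lia|]; rewrite IH by lia; apply Rmult_0_r.
Qed.

Lemma eigenvector_diag (t : R) (N : nat) : eigenvector t N N = 1.
Proof.
destruct N as [|N]; auto; rewrite eigenvector_succ.
destruct (Nat.eq_dec (S N) (S N)); [auto | lia].
Qed.

(** With the denominator cleared the recursion holds for every n: at n + 1 = N both sides vanish. *)
Lemma eigenvector_S (t : R) (N n : nat) :
  (INR n + 1 - INR N) * eigenvector t N (S n) =
  t * (INR n + 1) * eigenvector t N n.
Proof.
rewrite eigenvector_succ; destruct (Nat.eq_dec (S n) N) as [<-|Hn].
- rewrite eigenvector_below, S_INR by lia; ring.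
- rewrite <- S_INR; field; apply Rminus_eq_contra, not_INR, Hn.
Qed.

Lemma eigenvector_ge0 (t : R) (N n : nat) :
  0 <= t -> 0 <= eigenvector t N n.
Proof.
intros Ht; destruct (Nat.lt_ge_cases n N) as [Hn|Hn].
{ rewrite eigenvector_below by exact Hn; lra. }
induction Hn as [|n Hn IH]; [rewrite eigenvector_diag; lra|].
assert (Hn' : INR N <= INR n) by (apply le_INR, Hn).
assert (H := eigenvector_S t N n); assert (H' := pos_INR n).
assert (0 <= t * (INR n + 1) * eigenvector t N n).
{ apply Rmult_le_pos; auto; apply Rmult_le_pos; lra. }
nra.
Qed.

(** Up to powers of t this is the hockey-stick identity: the binomials (k choose N) for k <= n add
    up to (n+1 choose N+1), which is (n+1)/(N+1) times (n choose N). The induction on the numerator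
    runs through [eigenvector_S]. *)
Lemma cesaro_eigenvector (t : R) (N n : nat) :
  cesaro t (fun k => RtoC (eigenvector t N k)) n =
  RtoC (/ (INR N + 1) * eigenvector t N n).
Proof.
set (u := fun k => RtoC (eigenvector t N k)).
assert (HN : INR N + 1 <> 0) by (generalize (pos_INR N); lra).
assert (Hn : INR n + 1 <> 0) by (generalize (pos_INR n); lra).
enough (E : cesaro_sum t u n =
            RtoC ((INR n + 1) * (/ (INR N + 1) * eigenvector t N n))).
{ unfold cesaro; fold (cesaro_sum t u n); rewrite E, <- RtoC_div by exact Hn.
  f_equal; field; auto. }
clear Hn; induction n as [|n IH].
- rewrite cesaro_sum_0; unfold u; f_equal; simpl.
  destruct (Nat.eq_dec N 0) as [->|]; simpl; field; auto.
- rewrite cesaro_sum_S, IH; unfold u; rewrite <- RtoC_mult, <- RtoC_plus.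
  f_equal; assert (H := eigenvector_S t N n); rewrite S_INR.
  apply (Rmult_eq_reg_l (INR N + 1)); auto.
  replace ((INR N + 1) * (t * ((INR n + 1) *
    (/ (INR N + 1) * eigenvector t N n)) + eigenvector t N (S n)))
    with (t * (INR n + 1) * eigenvector t N n +
          (INR N + 1) * eigenvector t N (S n)) by (field; auto).
  rewrite <- H; field; auto.
Qed.

(** * Estimates in the Hahn space *)

Section Hahn.

Variable d : nat -> R.
Hypothesis d_ge1 : forall n : nat, 1 <= d n.
Hypothesis d_growing : Un_growing d.

Local Notation hd := (hahn d d_ge1).
Local Notation var u := (fun k => d k * Cmod (u (S k) - u k)%C).

Lemma hahn_minusE (x y : hd) (n : nat) : minus x y n = (x n - y n)%C.
Proof. simpl; ring. Qed.

(** The partial sums of the variation increase, so one bound gives both membership in the space and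
    the norm estimate. *)
Lemma hahn_intro (u : nat -> C) (M : R) :
  is_lim_seq (fun n => Cmod (u n)) 0 -> (forall n, sum_n (var u) n <= M) ->
  exists x : hd, (forall n, x n = u n) /\ norm x <= M.
Proof.
intros Hu HM.
destruct (ex_finite_lim_seq_incr (sum_n (var u)) M) as [s Hs]; auto.
{ intros n; apply sum_n_mono; [apply hahn_term_ge0; auto | lia]. }
assert (Hsum : ex_series (var u)) by (exists s; exact Hs).
exists (Hahn u Hu Hsum); split; auto.
exact (is_lim_seq_le (sum_n (var u)) (fun _ => M) (Finite (Series _)) M HM
  (Series_correct _ Hsum) (is_lim_seq_const M)).
Qed.

(** For a null sequence x_n is minus the sum of the increments from n on, and d_n <= d_k there
    because d increases. *)
Lemma hahn_coord_le (x : hd) (n : nat) : d n * Cmod (x n) <= norm x.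
Proof.
assert (dmono : forall i j, d i <= d (i + j)%nat).
{ intros i j; induction j as [|j IH]; [rewrite Nat.add_0_r; lra|].
  rewrite Nat.add_succ_r; apply Rle_trans with (1 := IH), d_growing. }
assert (H : forall m, d n * Cmod (x n) <=
          sum_n (var x) (n + m) + d n * Cmod (x (n + S m)%nat)).
{ induction m as [|m IH].
  - rewrite Nat.add_0_r, Nat.add_1_r.
    apply Rle_trans with (var x n + d n * Cmod (x (S n))).
    + rewrite <- Rmult_plus_distr_l; apply Rmult_le_compat_l.
      { generalize (d_ge1 n); lra. }
      replace (x n) with (- (x (S n) - x n) + x (S n))%C at 1 by ring.
      apply Rle_trans with (1 := Cmod_triangle _ _); rewrite Cmod_opp; lra.
    + apply Rplus_le_compat_r; destruct n as [|n]; [rewrite sum_O; lra|].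
      rewrite sum_Sn; unfold plus; simpl.
      generalize (sum_n_ge0 (var x) n (hahn_term_ge0 d d_ge1 x)); simpl; lra.
  - apply Rle_trans with (1 := IH); rewrite !Nat.add_succ_r, sum_Sn.
    set (p := S (n + m)); unfold plus; simpl.
    rewrite Rplus_assoc; apply Rplus_le_compat_l.
    apply Rle_trans with (d n * Cmod (x (S p) - x p)%C + d n * Cmod (x (S p))).
    + rewrite <- Rmult_plus_distr_l; apply Rmult_le_compat_l.
      { generalize (d_ge1 n); lra. }
      replace (x p) with (- (x (S p) - x p) + x (S p))%C at 1 by ring.
      apply Rle_trans with (1 := Cmod_triangle _ _); rewrite Cmod_opp; lra.
    + apply Rplus_le_compat_r, Rmult_le_compat_r; [apply Cmod_ge_0|].
      unfold p; rewrite <- Nat.add_succ_r; apply dmono. }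
assert (H' : forall m, d n * Cmod (x n) <=
          norm x + d n * Cmod (x (m + S n)%nat)).
{ intros m; apply Rle_trans with (1 := H m), Rplus_le_compat.
  - apply hahn_norm_ge_sum.
  - right; do 3 f_equal; lia. }
assert (L : is_lim_seq (fun m => norm x + d n * Cmod (x (m + S n)%nat))
              (norm x + d n * 0)).
{ apply is_lim_seq_plus'; [apply is_lim_seq_const|].
  apply is_lim_seq_mult'; [apply is_lim_seq_const|].
  apply (is_lim_seq_incr_n (fun m => Cmod (x m))), hahn_null. }
rewrite Rmult_0_r, Rplus_0_r in L.
exact (is_lim_seq_le (fun _ => d n * Cmod (x n)) _ _ _ H' (is_lim_seq_const _) L).
Qed.

(** Truncation creates a single new increment, from 0 to x_N, whose weighted size is at most
    [norm x] by [hahn_coord_le]; every other increment is kept or becomes 0. *)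
Lemma hahn_truncate (N : nat) (x : hd) :
  exists y : hd, (forall n, y n = if lt_dec n N then RtoC 0 else x n) /\
                 norm y <= 2 * norm x.
Proof.
set (u := fun n => if lt_dec n N then RtoC 0 else x n).
apply (hahn_intro u).
- apply is_lim_seq_0_le with (fun n => Cmod (x n)); [|apply hahn_null].
  intros n; split; [apply Cmod_ge_0|]; unfold u.
  destruct (lt_dec n N); [rewrite Cmod_0; apply Cmod_ge_0 | apply Rle_refl].
- assert (H0 : forall n, 0 <= var x n) by (apply (hahn_term_ge0 d d_ge1 x)).
  assert (Hx : 0 <= norm x) by apply norm_ge_0.
  assert (H1 : forall n, (S n <> N)%nat -> var u n <= var x n).
  { intros n Hn; unfold u.
    destruct (lt_dec n N), (lt_dec (S n) N); try lia; [|apply Rle_refl].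
    replace (0 - 0)%C with (RtoC 0) by ring; rewrite Cmod_0, Rmult_0_r.
    apply H0. }
  assert (H2 : forall n, (S n = N)%nat -> var u n <= norm x).
  { intros n Hn; unfold u.
    destruct (lt_dec n N), (lt_dec (S n) N); try lia.
    replace (x (S n) - 0)%C with (x (S n)) by ring.
    apply Rle_trans with (2 := hahn_coord_le x (S n)).
    apply Rmult_le_compat_r; [apply Cmod_ge_0 | apply d_growing]. }
  (* The jump sits at index N - 1, so it is counted only once n + 1 >= N. *)
  assert (H : forall n, sum_n (var u) n <=
     sum_n (var x) n + (if lt_dec (S n) N then 0 else norm x)).
  { induction n as [|n IH].
    - rewrite !sum_O; destruct (Nat.eq_dec 1 N) as [E|E].
      + destruct (lt_dec 1 N); [lia|].
        generalize (H2 0%nat E) (H0 0%nat); simpl; lra.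
      + generalize (H1 0%nat E); destruct (lt_dec 1 N); simpl; lra.
    - rewrite !sum_Sn; unfold plus; simpl.
      destruct (Nat.eq_dec (S (S n)) N) as [E|E].
      + destruct (lt_dec (S n) N), (lt_dec (S (S n)) N); try lia.
        generalize (H2 (S n) E) (H0 (S n)); simpl; lra.
      + generalize (H1 (S n) E); simpl.
        destruct (lt_dec (S n) N), (lt_dec (S (S n)) N); try lia; lra. }
  intros n; apply Rle_trans with (1 := H n).
  assert (Hs : sum_n (var x) n <= norm x) by apply hahn_norm_ge_sum.
  destruct (lt_dec (S n) N); lra.
Qed.

(** * Eigenvectors in the Hahn space and smallness of the matrix on h^N *)

Hypothesis d_ratio_lim : is_lim_seq (fun k : nat => d (k + 1)%nat / d k) 1.

Variable t : R.
Hypothesis t_ge0 : 0 <= t.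
Hypothesis t_lt1 : t < 1.

Lemma weight_ratio_eventually :
  exists (K : nat) (q : R), 0 <= q < 1 /\
    forall k, (K <= k)%nat -> t * d (S k) <= q * d k.
Proof.
(* A ratio below 1 + (1-t)/2, multiplied by t, stays below q = (1+t)/2. *)
assert (He : 0 < (1 - t) / 2) by lra.
generalize d_ratio_lim; intros L; apply is_lim_seq_spec in L.
destruct (L (mkposreal _ He)) as [K HK].
exists K, ((1 + t) / 2); split; [lra|]; intros k Hk.
generalize (HK k Hk); simpl; intros H; apply Rabs_def2 in H.
rewrite Nat.add_1_r in H; assert (Hd := d_ge1 k).
replace (d (S k)) with (d (S k) / d k * d k) by (field; lra).
rewrite <- Rmult_assoc; apply Rmult_le_compat_r; [lra|].
apply Rle_trans with (t * (1 + (1 - t) / 2)); [apply Rmult_le_compat_l; lra|].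
nra.
Qed.

Lemma eigenvector_hahn (N : nat) :
  exists v : hd, forall n, v n = RtoC (eigenvector t N n).
Proof.
destruct weight_ratio_eventually as (K & q & Hq & HK).
set (a := fun k => d k * eigenvector t N k).
assert (Ha : forall k, 0 <= a k).
{ intros k; apply Rmult_le_pos; [apply d_ge0, d_ge1|].
  apply eigenvector_ge0, t_ge0. }
(* The ratios of the terms [a] are at most q(k+1)/(k+1-N) and so eventually below [p], which lies
   strictly between q and 1. The index [K'] enforces q(k+1) <= p(k+1-N). *)
set (p := (1 + q) / 2).
destruct (nfloor_ex (p * INR N / (p - q))) as [K' [_ HK']].
{ apply Rdiv_le_0_compat; [apply Rmult_le_pos; [unfold p; lra | apply pos_INR]|].
  unfold p; lra. }
assert (Ea : ex_series a).
{ apply ex_series_ratio with p (K + K' + N)%nat; auto; [unfold p; lra|].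
  intros k Hk; unfold a.
  assert (HN := pos_INR N).
  assert (HNk : INR N <= INR k) by (apply le_INR; lia).
  assert (HKk : INR K' <= INR k) by (apply le_INR; lia).
  assert (Hw := eigenvector_ge0 t N k t_ge0).
  assert (Hk1 : 0 < INR k + 1 - INR N) by lra.
  apply Rmult_le_reg_l with (1 := Hk1).
  replace ((INR k + 1 - INR N) * (d (S k) * eigenvector t N (S k)))
    with (d (S k) * ((INR k + 1 - INR N) * eigenvector t N (S k))) by ring.
  rewrite eigenvector_S.
  replace (d (S k) * (t * (INR k + 1) * eigenvector t N k))
    with (t * d (S k) * ((INR k + 1) * eigenvector t N k)) by ring.
  apply Rle_trans with (q * d k * ((INR k + 1) * eigenvector t N k)).
  { apply Rmult_le_compat_r; [apply Rmult_le_pos; lra | apply HK; lia]. }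
  replace (q * d k * ((INR k + 1) * eigenvector t N k))
    with (q * (INR k + 1) * (d k * eigenvector t N k)) by ring.
  replace ((INR k + 1 - INR N) * (p * (d k * eigenvector t N k)))
    with ((INR k + 1 - INR N) * p * (d k * eigenvector t N k)) by ring.
  apply Rmult_le_compat_r; [apply Ha|].
  assert (HK2 : p * INR N <= (INR k + 1) * (p - q)); [|lra].
  apply Rle_div_l; [unfold p|]; lra. }
assert (Hle : forall n, Cmod (RtoC (eigenvector t N n)) <= a n).
{ intros n; assert (H := eigenvector_ge0 t N n t_ge0).
  rewrite Cmod_R, Rabs_pos_eq by exact H; unfold a.
  generalize (d_ge1 n); nra. }
unshelve eexists (Hahn (fun n => RtoC (eigenvector t N n)) _ _); auto.
- apply is_lim_seq_0_le with a; [|apply ex_series_lim_0, Ea].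
  intros n; split; [apply Cmod_ge_0 | apply Hle].
(* Each increment is bounded by the sum of its two entries, and d_k <= d_{k+1} turns this into
   consecutive terms of [a]. *)
- apply (ex_series_le (K := R_AbsRing) (V := R_CompleteNormedModule))
    with (fun k => a (S k) + a k).
  + intros k; change (Rabs (d k * Cmod (RtoC (eigenvector t N (S k)) -
      RtoC (eigenvector t N k))%C) <= a (S k) + a k).
    rewrite Rabs_pos_eq
      by (apply Rmult_le_pos; [apply d_ge0, d_ge1 | apply Cmod_ge_0]).
    rewrite <- RtoC_minus, Cmod_R; unfold a.
    assert (H1 := eigenvector_ge0 t N k t_ge0).
    assert (H2 := eigenvector_ge0 t N (S k) t_ge0).
    assert (Hd := d_ge1 k); assert (Hd' := d_growing k).
    apply Rle_trans with (d k * (eigenvector t N (S k) + eigenvector t N k)).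
    * apply Rmult_le_compat_l; [lra|]; apply Rabs_le; lra.
    * rewrite Rmult_plus_distr_l; apply Rplus_le_compat_r.
      apply Rmult_le_compat_r; auto.
  + apply (ex_series_plus (V := R_NormedModule)); auto.
    apply ex_series_incr_1 in Ea; exact Ea.
Qed.

(* The defining recursion of the numerator [cesaro_sum t x] and of its
   increments is a contraction for the weights d beyond the index where
   t d_{k+1} <= q d_k. *)
Lemma cesaro_small (e : posreal) :
  exists N : nat, forall x : hd, vanishes_below N x ->
    exists y : hd, (forall n, y n = cesaro t x n) /\ norm y <= e * norm x.
Proof.
destruct weight_ratio_eventually as (K & q & Hq & HK).
(* [K'] is chosen so that the final bound 2B/N, with B = [norm x]/(1-q), is at most e times
   [norm x]. *)
destruct (nfloor_ex (2 / ((1 - q) * e))) as [K' [_ HK']].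
{ apply Rdiv_le_0_compat; [lra|].
  apply Rmult_lt_0_compat; [lra | apply cond_pos]. }
(* The successor forces x_0 = 0, and n + 1 >= N gives n >= K, where the weight inequality is
   available. *)
set (N := S (K + K')); exists N; intros x Hx.
assert (Hnx : 0 <= norm x) by apply norm_ge_0.
(* [B] is the fixed point of b -> qb + [norm x], hence an invariant bound for the weighted
   recursion. *)
set (B := norm x / (1 - q)).
assert (HB : 0 <= B) by (apply Rdiv_le_0_compat; lra).
assert (HqB : q * B + norm x = B) by (unfold B; field; lra).
set (s := cesaro_sum t x).
assert (Hs0 : vanishes_below N s) by (apply cesaro_sum_vanishes, Hx).
assert (d0 : forall n, 0 < d n) by (intros n; generalize (d_ge1 n); lra).
assert (Hs : forall n, d n * Cmod (s n) <= B).
{ induction n as [|n IH].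
  { rewrite Hs0, Cmod_0 by (unfold N; lia); lra. }
  destruct (lt_dec (S n) N) as [Hn|Hn].
  { rewrite Hs0, Cmod_0 by exact Hn; lra. }
  unfold s; rewrite cesaro_sum_S; fold s.
  apply Rle_trans with (d (S n) * (t * Cmod (s n) + Cmod (x (S n)))).
  - apply Rmult_le_compat_l; [apply Rlt_le, d0|].
    apply Rle_trans with (1 := Cmod_triangle _ _).
    rewrite Cmod_mult, Cmod_R, Rabs_pos_eq by exact t_ge0; lra.
  - rewrite Rmult_plus_distr_l, <- HqB; apply Rplus_le_compat.
    + apply Rle_trans with (q * (d n * Cmod (s n))).
      * rewrite <- !Rmult_assoc, (Rmult_comm (d (S n))).
        apply Rmult_le_compat_r; [apply Cmod_ge_0|].
        apply HK; unfold N in Hn; lia.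
      * apply Rmult_le_compat_l; [apply Hq | exact IH].
    + apply hahn_coord_le. }
assert (Hvar : forall n, sum_n (var s) n <= B).
{ intros n.
  assert (H : (1 - q) * sum_n (var s) n <= norm x).
  2: { unfold B; apply Rle_div_r; lra. }
  apply Rle_trans with (sum_n (var x) n); [|apply hahn_norm_ge_sum].
  assert (Hv0 : forall n, 0 <= var s n) by (apply (hahn_term_ge0 d d_ge1)).
  (* Increment n+1 of s is controlled by q times increment n, so summation shifts the index by one.
     The extra term q [var s n] accounts for the last increment and lets the induction close. *)
  enough (H : sum_n (var s) n + q * var s n <=
              q * sum_n (var s) n + sum_n (var x) n).
  { assert (0 <= q * var s n) by (apply Rmult_le_pos; [lra | apply Hv0]); lra. }
  induction n as [|n IH].
  - rewrite !sum_O; unfold s; rewrite cesaro_sum_S, cesaro_sum_0.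
    rewrite (Hx 0%nat) by (unfold N; lia).
    replace (t * 0 + x 1%nat - 0)%C with (x 1%nat - 0)%C by ring; lra.
  - rewrite !sum_Sn; unfold plus; simpl.
    assert (Hstep : d (S n) * Cmod (s (S (S n)) - s (S n))%C <=
      q * (d n * Cmod (s (S n) - s n)%C) +
      d (S n) * Cmod (x (S (S n)) - x (S n))%C); [|simpl in IH; lra].
    replace (s (S (S n)) - s (S n))%C
      with (t * (s (S n) - s n) + (x (S (S n)) - x (S n)))%C
      by (unfold s; rewrite (cesaro_sum_S t x (S n)), (cesaro_sum_S t x n); ring).
    apply Rle_trans with (d (S n) * (t * Cmod (s (S n) - s n)%C +
      Cmod (x (S (S n)) - x (S n))%C)).
    + apply Rmult_le_compat_l; [apply Rlt_le, d0|].
      apply Rle_trans with (1 := Cmod_triangle _ _).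
      rewrite Cmod_mult, Cmod_R, Rabs_pos_eq by exact t_ge0; lra.
    + rewrite Rmult_plus_distr_l; apply Rplus_le_compat_r.
      destruct (lt_dec (S n) N) as [Hn|Hn].
      * rewrite !Hs0 by lia; replace (0 - 0)%C with (RtoC 0) by ring.
        rewrite Cmod_0; lra.
      * rewrite <- !Rmult_assoc, (Rmult_comm (d (S n))).
        apply Rmult_le_compat_r; [apply Cmod_ge_0|].
        apply HK; unfold N in Hn; lia. }
assert (HN0 : 0 < INR N) by (apply lt_0_INR; unfold N; lia).
destruct (hahn_intro (cesaro t x) (2 * B / INR N)) as (y & Hy & Hny).
- apply is_lim_seq_0_le with (fun n => B * / (INR n + 1)).
  + intros n; split; [apply Cmod_ge_0|]; unfold cesaro.
    fold (cesaro_sum t x n); fold s.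
    assert (Hn := pos_INR n).
    rewrite Cmod_div by apply INR1_neq0.
    rewrite Cmod_R, Rabs_pos_eq by lra.
    apply Rmult_le_compat_r; [apply Rlt_le, Rinv_0_lt_compat; lra|].
    apply Rle_trans with (2 := Hs n).
    generalize (d_ge1 n) (Cmod_ge_0 (s n)); nra.
  + replace (Finite 0) with (Rbar_mult B 0) by (simpl; f_equal; ring).
    apply is_lim_seq_scal_l; replace (Finite 0) with (Rbar_inv p_infty) by auto.
    apply is_lim_seq_inv; [|discriminate].
    apply is_lim_seq_plus with p_infty 1; [apply is_lim_seq_INR| |reflexivity].
    apply is_lim_seq_const.
(* Discrete quotient rule: an increment of s_n/(n+1) is (s_{n+1} - s_n)/(n+2) minus s_n (1/(n+1) -
   1/(n+2)). The first part is summed by [Hvar], the second telescopes. *)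
- assert (Hterm : forall n, (N <= S n)%nat -> var (cesaro t x) n <=
    var s n / (INR N + 1) + B * (/ (INR n + 1) - / (INR n + 2))).
  { intros n Hn; assert (Hn0 := pos_INR n).
    assert (HNn : INR N <= INR n + 1) by (rewrite <- S_INR; apply le_INR, Hn).
    assert (E : (cesaro t x (S n) - cesaro t x n)%C =
      ((s (S n) - s n) * RtoC (/ (INR n + 2)) +
       - (s n * RtoC (/ (INR n + 1) - / (INR n + 2))))%C).
    { unfold cesaro; fold (cesaro_sum t x n) (cesaro_sum t x (S n)); fold s.
      rewrite S_INR; replace (INR n + 1 + 1) with (INR n + 2) by ring.
      unfold Cdiv; rewrite <- !RtoC_inv, RtoC_minus by lra; ring. }
    rewrite E.
    apply Rle_trans with (d n * (Cmod (s (S n) - s n)%C * / (INR n + 2) +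
      Cmod (s n) * (/ (INR n + 1) - / (INR n + 2)))).
    - apply Rmult_le_compat_l; [apply Rlt_le, d0|].
      apply Rle_trans with (1 := Cmod_triangle _ _); right.
      rewrite Cmod_opp, !Cmod_mult, !Cmod_R; f_equal; f_equal; apply Rabs_pos_eq.
      + apply Rlt_le, Rinv_0_lt_compat; lra.
      + apply Rge_le, Rge_minus, Rle_ge, Rinv_le_contravar; lra.
    - rewrite Rmult_plus_distr_l, <- !Rmult_assoc; apply Rplus_le_compat.
      + apply Rmult_le_compat_l; [apply (hahn_term_ge0 d d_ge1 s)|].
        apply Rinv_le_contravar; lra.
      + apply Rmult_le_compat_r; [|apply Hs].
        apply Rge_le, Rge_minus, Rle_ge, Rinv_le_contravar; lra. }
  assert (Hterm0 : forall n, (S n < N)%nat -> var (cesaro t x) n = 0).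
  { intros n Hn; rewrite !(cesaro_vanishes t x N Hx) by lia.
    replace (0 - 0)%C with (RtoC 0) by ring; rewrite Cmod_0; ring. }
  assert (Hv0 : forall n, 0 <= var s n) by (apply (hahn_term_ge0 d d_ge1)).
  assert (HiN : / (INR N + 1) <= / INR N) by (apply Rinv_le_contravar; lra).
  assert (HiN0 : 0 < / (INR N + 1)) by (apply Rinv_0_lt_compat; lra).
  (* Nonzero increments start at index N - 1, so the telescoping sum is 1/N - 1/(n+2). *)
  assert (Hsum : forall n, sum_n (var (cesaro t x)) n <=
     sum_n (var s) n / (INR N + 1) +
     B * (if lt_dec (S n) N then 0 else / INR N - / (INR n + 2))).
  { induction n as [|n IH].
    - rewrite !sum_O; destruct (lt_dec 1 N) as [Hn|Hn].
      + rewrite Hterm0, Rmult_0_r, Rplus_0_r by exact Hn.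
        apply Rmult_le_pos; [apply Hv0 | lra].
      + apply Rle_trans with (1 := Hterm 0%nat ltac:(lia)), Req_le.
        replace (INR N) with (INR 0 + 1); auto.
        rewrite <- S_INR; f_equal; unfold N in *; lia.
    - rewrite !sum_Sn; unfold plus; simpl Hierarchy.AbelianMonoid.plus.
      cbv beta.
      destruct (lt_dec (S (S n)) N) as [Hn|Hn].
      + destruct (lt_dec (S n) N); [|lia].
        assert (H := Hv0 (S n)); rewrite (Hterm0 (S n)) by exact Hn.
        unfold Rdiv in *; nra.
      + assert (H := Hterm (S n) ltac:(lia)); rewrite S_INR in *.
        replace (INR n + 1 + 1) with (INR n + 2) in * by ring.
        destruct (lt_dec (S n) N) as [Hn'|Hn'].
        * replace (INR N) with (INR n + 2) in *; [lra|].
          replace N with (S (S n)) by lia; rewrite !S_INR; ring.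
        * lra. }
  intros n; apply Rle_trans with (1 := Hsum n).
  replace (2 * B / INR N) with (B * / INR N + B * / INR N) by (field; lra).
  apply Rplus_le_compat.
  + apply Rle_trans with (B * / (INR N + 1)).
    * apply Rmult_le_compat_r; [lra | apply Hvar].
    * apply Rmult_le_compat_l; lra.
  + apply Rmult_le_compat_l; auto; destruct (lt_dec (S n) N); [lra|].
    assert (0 < / (INR n + 2)); [|lra].
    apply Rinv_0_lt_compat; generalize (pos_INR n); lra.
- exists y; split; auto; apply Rle_trans with (1 := Hny).
  apply Rle_div_l; auto; unfold B.
  replace (2 * (norm x / (1 - q))) with (2 / ((1 - q) * e) * (e * norm x))
    by (field; split; [lra | apply Rgt_not_eq, cond_pos]).
  rewrite (Rmult_comm (e * norm x)); apply Rmult_le_compat_r.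
  { apply Rmult_le_pos; [apply Rlt_le, cond_pos | auto]. }
  apply Rlt_le, Rlt_le_trans with (1 := HK'); rewrite <- S_INR; apply le_INR.
  unfold N; lia.
Qed.

(** * Truncation operators, splitting along eigenvectors, and boundedness *)

Lemma hahn_norm_scalE (a : C) (x : hd) : norm (scal a x) = Cmod a * norm x.
Proof. apply hahn_norm_scal. Qed.

Lemma hahn_norm_plus_le (x y : hd) : norm (plus x y) <= norm x + norm y.
Proof. apply hahn_norm_plus. Qed.

Lemma hahn_norm_minus_le (x y : hd) : norm (minus x y) <= norm x + norm y.
Proof.
apply Rle_trans with (1 := hahn_norm_plus_le _ _).
apply Rplus_le_compat_l, Req_le, hahn_norm_opp.
Qed.

Lemma hahn_truncation (N : nat) :
  exists Q : hd -> hd, is_linear Q /\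
    (forall x n, Q x n = if lt_dec n N then RtoC 0 else x n) /\
    (forall x, norm (Q x) <= 2 * norm x).
Proof.
destruct (functional_choice _ (hahn_truncate N)) as [Q HQ].
assert (QE : forall x n, Q x n = if lt_dec n N then RtoC 0 else x n)
  by (intros x; apply HQ).
exists Q; split; [|split]; [|exact QE|intros x; apply HQ].
split.
- intros x y; apply hahn_eq; intros n; simpl.
  rewrite !QE; simpl; destruct (lt_dec n N); ring.
- intros a x; apply hahn_eq; intros n; simpl.
  rewrite !QE; simpl; destruct (lt_dec n N); ring.
- exists 2; split; [lra | intros x; apply HQ].
Qed.

(** The coordinate vector is the difference of two consecutive truncations of v_N, whose entry at N
    is 1. *)
Lemma hahn_unit (N : nat) :
  exists e : hd, forall n, e n = if Nat.eq_dec n N then RtoC 1 else RtoC 0.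
Proof.
destruct (eigenvector_hahn N) as [v Hv].
destruct (hahn_truncate N v) as (p & Hp & _).
destruct (hahn_truncate (S N) v) as (q & Hq & _).
exists (minus p q); intros n; rewrite hahn_minusE, Hp, Hq, Hv.
destruct (lt_dec n N), (lt_dec n (S N)), (Nat.eq_dec n N) as [->|];
  try lia; try ring.
rewrite eigenvector_diag; ring.
Qed.

(** Since v_N has entry 1 at N, subtracting x_N v_N clears that coordinate. The norm bound makes the
    descent from h^(N+1) to h^N quantitative. *)
Lemma hahn_split (N : nat) (v x : hd) :
  (forall n, v n = RtoC (eigenvector t N n)) -> vanishes_below N x ->
  exists z : hd, vanishes_below (S N) z /\
    x = plus (scal (x N) v) z /\ norm z <= (1 + norm v) * norm x.
Proof.
intros Hv Hx; exists (minus x (scal (x N) v)); split; [|split].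
- intros n Hn; rewrite hahn_minusE; simpl; rewrite Hv.
  destruct (Nat.eq_dec n N) as [->|].
  + rewrite eigenvector_diag; ring.
  + rewrite Hx, eigenvector_below by lia; ring.
- apply hahn_eq; intros n; simpl; ring.
- apply Rle_trans with (1 := hahn_norm_minus_le _ _); rewrite hahn_norm_scalE.
  assert (H := hahn_norm_ge_coord d d_ge1 x N); change (hahn_norm x) with (norm x) in H.
  assert (Hv0 : 0 <= norm v) by apply norm_ge_0.
  assert (Cmod (x N) * norm v <= norm x * norm v); [|lra].
  apply Rmult_le_compat_r; auto.
Qed.

Lemma cesaro_bounded :
  exists M : R, 0 <= M /\ forall x : hd,
    exists y : hd, (forall n, y n = cesaro t x n) /\ norm y <= M * norm x.
Proof.
set (P := fun N => exists M : R, 0 <= M /\ forall x : hd, vanishes_below N x ->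
  exists y : hd, (forall n, y n = cesaro t x n) /\ norm y <= M * norm x).
enough (H : P 0%nat).
{ destruct H as (M & HM & H); exists M; split; auto.
  intros x; apply H; intros n Hn; lia. }
destruct (cesaro_small (mkposreal 1 Rlt_0_1)) as [N HN].
apply nat_downward_ind with N; [exists 1; split; [lra | exact HN]|].
clear N HN; intros N (M & HM & H); destruct (eigenvector_hahn N) as [v Hv].
assert (Hv0 : 0 <= norm v) by apply norm_ge_0.
exists (norm v + M * (1 + norm v)); split.
{ apply Rplus_le_le_0_compat; auto; apply Rmult_le_pos; lra. }
intros x Hx; destruct (hahn_split N v x Hv Hx) as (z & Hz & Exz & Hzn).
destruct (H z Hz) as (y & Hy & Hyn).
(* The matrix multiplies the component x_N v_N by its eigenvalue 1/(N+1); [y] is the image of the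
   remainder. *)
exists (plus (scal (x N * RtoC (/ (INR N + 1)))%C v) y); split.
- intros n; simpl; rewrite Hy, Hv.
  rewrite Exz at 2; simpl; rewrite (cesaro_plus t (fun k => x N * v k)%C z).
  rewrite cesaro_scal; f_equal.
  rewrite (cesaro_ext t v _ n Hv), cesaro_eigenvector, RtoC_mult; ring.
- apply Rle_trans with (1 := hahn_norm_plus_le _ _).
  rewrite hahn_norm_scalE, Rmult_plus_distr_r; apply Rplus_le_compat.
  + rewrite Rmult_comm; apply Rmult_le_compat_l; auto.
    rewrite Cmod_mult, Cmod_R; assert (HN := pos_INR N).
    rewrite Rabs_pos_eq by (apply Rlt_le, Rinv_0_lt_compat; lra).
    rewrite <- (Rmult_1_r (norm x)).
    apply Rmult_le_compat; [apply Cmod_ge_0 | | apply hahn_norm_ge_coord |].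
    * apply Rlt_le, Rinv_0_lt_compat; lra.
    * rewrite <- Rinv_1; apply Rinv_le_contravar; lra.
  + apply Rle_trans with (1 := Hyn); rewrite Rmult_assoc.
    apply Rmult_le_compat_l; auto.
Qed.

Lemma cesaro_operator :
  exists T : hd -> hd, (forall x n, T x n = cesaro t x n) /\ is_linear T.
Proof.
destruct cesaro_bounded as (M & HM & H).
apply functional_choice in H; destruct H as [T HT].
assert (TE : forall x n, T x n = cesaro t x n) by (intros x; apply HT).
exists T; split; auto; split.
- intros x y; apply hahn_eq; intros n; simpl.
  rewrite !TE; apply (cesaro_plus t x y).
- intros a x; apply hahn_eq; intros n; simpl.
  rewrite !TE; apply (cesaro_scal t a x).
(* [is_linear] asks for a strictly positive constant, and [M] may be 0. *)
- exists (M + 1); split; [lra|]; intros x.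
  apply Rle_trans with (1 := proj2 (HT x)), Rmult_le_compat_r; [|lra].
  apply norm_ge_0.
Qed.

(** * Dynamics and spectrum of the Cesaro operator *)

Variable T : hd -> hd.
Hypothesis TE : forall x n, T x n = cesaro t x n.
Hypothesis T_linear : is_linear T.

Lemma operator_small (e : posreal) :
  exists N : nat, forall x : hd,
    vanishes_below N x -> norm (T x) <= e * norm x.
Proof.
destruct (cesaro_small e) as [N HN]; exists N; intros x Hx.
destruct (HN x Hx) as (y & Hy & Hyn).
replace (T x) with y; auto; apply hahn_eq; intros n; rewrite TE; auto.
Qed.

Lemma operator_vanishes (N : nat) (x : hd) :
  vanishes_below N x -> vanishes_below N (T x).
Proof. intros Hx n Hn; rewrite TE; apply (cesaro_vanishes t x N Hx n Hn). Qed.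

Lemma operator_eigenvector (N : nat) (v : hd) :
  (forall n, v n = RtoC (eigenvector t N n)) ->
  T v = scal (RtoC (/ (INR N + 1))) v.
Proof.
intros Hv; apply hahn_eq; intros n; rewrite TE; simpl; rewrite Hv.
rewrite (cesaro_ext t v _ n Hv), cesaro_eigenvector, RtoC_mult; reflexivity.
Qed.

Lemma power_vanishes (N n : nat) (x : hd) :
  vanishes_below N x -> vanishes_below N (power T n x).
Proof.
intros Hx; induction n as [|n IH]; auto; apply operator_vanishes, IH.
Qed.

(** For large N the operator contracts the invariant subspace h^N by 1/2, which iterates. The
    vectors added while descending to h^1 have eigenvalues 1/(N+2) <= 1/2; the descent stops there
    because v_0 has eigenvalue 1. *)
Lemma power_decay :
  exists M : R, 0 <= M /\ forall x : hd, vanishes_below 1 x ->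
    forall n, norm (power T n x) <= M * ((1 / 2) ^ n * norm x).
Proof.
set (P := fun N => exists M : R, 0 <= M /\
  forall x : hd, vanishes_below (S N) x ->
    forall n, norm (power T n x) <= M * ((1 / 2) ^ n * norm x)).
change (P 0%nat).
assert (H2 : 0 < 1 / 2) by lra.
destruct (operator_small (mkposreal _ H2)) as [N HN].
apply nat_downward_ind with N.
{ exists 1; split; [lra|]; intros x Hx n; rewrite Rmult_1_l.
  induction n as [|n IH]; [simpl; lra|].
  apply Rle_trans with (1 / 2 * norm (power T n x)).
  - apply HN; intros k Hk; apply (power_vanishes (S N)); auto.
  - simpl; rewrite Rmult_assoc; apply Rmult_le_compat_l; [lra | exact IH]. }
clear N HN; intros N (M & HM & H); destruct (eigenvector_hahn (S N)) as [v Hv].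
assert (Hv0 : 0 <= norm v) by apply norm_ge_0.
exists (norm v + M * (1 + norm v)); split.
{ apply Rplus_le_le_0_compat; auto; apply Rmult_le_pos; lra. }
intros x Hx n; destruct (hahn_split (S N) v x Hv Hx) as (z & Hz & Exz & Hzn).
assert (L := power_linear T n T_linear).
rewrite Exz at 1; rewrite (linear_plus _ L), (linear_scal _ L).
rewrite (power_eigenvector T (/ (INR (S N) + 1)) v n T_linear
  (operator_eigenvector _ v Hv)).
apply Rle_trans with (1 := hahn_norm_plus_le _ _).
assert (Hp : 0 <= (1 / 2) ^ n) by (apply pow_le; lra).
rewrite Rmult_plus_distr_r; apply Rplus_le_compat.
- rewrite !hahn_norm_scalE, Cmod_R, Rmult_comm, Rmult_assoc.
  rewrite (Rmult_comm (norm v) ((1/2)^n * norm x)), Rmult_assoc.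
  rewrite (Rmult_comm (norm v) (Cmod (x (S N)))).
  apply Rmult_le_compat.
  + apply Rabs_pos.
  + apply Rmult_le_pos; auto; apply Cmod_ge_0.
  + assert (HN := pos_INR N); rewrite S_INR.
    rewrite Rabs_pos_eq by (apply pow_le, Rlt_le, Rinv_0_lt_compat; lra).
    apply pow_incr; split; [apply Rlt_le, Rinv_0_lt_compat; lra|].
    rewrite <- (Rinv_inv (1 / 2)); apply Rinv_le_contravar; lra.
  + apply Rmult_le_compat_r; auto; apply hahn_norm_ge_coord.
- apply Rle_trans with (1 := H z Hz n); rewrite Rmult_assoc.
  apply Rmult_le_compat_l; auto.
  replace ((1 + norm v) * ((1 / 2) ^ n * norm x))
    with ((1 / 2) ^ n * ((1 + norm v) * norm x)) by ring.
  apply Rmult_le_compat_l; auto.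
Qed.

Lemma power_asymptotics (v : hd) :
  (forall n, v n = RtoC (eigenvector t 0 n)) ->
  exists M : R, 0 <= M /\ forall (x : hd) n, exists w : hd,
    power T n x = plus (scal (x 0%nat) v) w /\
    norm w <= M * ((1 / 2) ^ n * norm x).
Proof.
intros Hv; destruct power_decay as (M & HM & H).
assert (Hv0 : 0 <= norm v) by apply norm_ge_0.
exists (M * (1 + norm v)); split; [apply Rmult_le_pos; lra|].
intros x n; destruct (hahn_split 0 v x Hv) as (z & Hz & Exz & Hzn).
{ intros k Hk; lia. }
assert (L := power_linear T n T_linear).
exists (power T n z); split.
- rewrite Exz at 1; rewrite (linear_plus _ L), (linear_scal _ L).
  rewrite (power_eigenvector T (/ (INR 0 + 1)) v n T_linear
  (operator_eigenvector _ v Hv)).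
  f_equal; apply hahn_eq; intros k; simpl.
  replace (/ (0 + 1)) with 1 by field; rewrite pow1; ring.
- apply Rle_trans with (1 := H z Hz n); rewrite Rmult_assoc.
  apply Rmult_le_compat_l; auto.
  replace ((1 + norm v) * ((1 / 2) ^ n * norm x))
    with ((1 / 2) ^ n * ((1 + norm v) * norm x)) by ring.
  apply Rmult_le_compat_l; auto; apply pow_le; lra.
Qed.

Lemma operator_power_bounded : power_bounded T.
Proof.
destruct (eigenvector_hahn 0) as [v Hv].
destruct (power_asymptotics v Hv) as (M & HM & H).
assert (Hv0 : 0 <= norm v) by apply norm_ge_0.
exists (norm v + M); intros n _; apply op_norm_le; [lra|].
intros x; destruct (H x n) as (w & -> & Hw).
apply Rle_trans with (1 := hahn_norm_plus_le _ _).
rewrite hahn_norm_scalE, Rmult_plus_distr_r; apply Rplus_le_compat.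
- rewrite Rmult_comm; apply Rmult_le_compat_l; auto; apply hahn_norm_ge_coord.
- apply Rle_trans with (1 := Hw), Rmult_le_compat_l; auto.
  rewrite <- (Rmult_1_l (norm x)) at 2; apply Rmult_le_compat_r.
  + apply norm_ge_0.
  + apply Rle_trans with (1 ^ n); [apply pow_incr; lra | rewrite pow1; lra].
Qed.

Lemma operator_uniformly_mean_ergodic : uniformly_mean_ergodic T.
Proof.
destruct (eigenvector_hahn 0) as [v Hv].
destruct (power_asymptotics v Hv) as (M & HM & H).
assert (Hv0 : 0 <= norm v) by apply norm_ge_0.
(* The limit of the means is the projection onto the fixed vector v_0 along h^1. *)
exists (fun x : hd => scal (x 0%nat) v); split; [split|].
- intros x y; apply hahn_eq; intros n; simpl; ring.
- intros a x; apply hahn_eq; intros n; simpl; ring.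
- exists (norm v + 1); split; [lra|]; intros x.
  rewrite hahn_norm_scalE, Rmult_comm.
  apply Rmult_le_compat; auto; [apply Cmod_ge_0 | lra | apply hahn_norm_ge_coord].
- intros e; destruct (nfloor_ex (M / e)) as [N [_ HN]].
  { apply Rdiv_le_0_compat; [exact HM | apply cond_pos]. }
  exists (S N); intros n Hn1 HnN.
  assert (Hn0 : 0 < INR n) by (apply lt_0_INR; lia).
  apply Rbar_le_lt_trans with (M / INR n).
  2: { simpl; apply Rlt_div_l; auto; rewrite Rmult_comm; apply Rlt_div_l.
       - apply cond_pos.
       - apply Rlt_le_trans with (1 := HN); rewrite <- S_INR; apply le_INR, HnN. }
  apply op_norm_le; [apply Rdiv_le_0_compat; auto|]; intros x.
  assert (Hx0 : 0 <= norm x) by apply norm_ge_0.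
  (* The errors (1/2)^m for m = 1, ..., n add up to 1 - (1/2)^n, so dividing by n leaves a mean
     error of at most [M]/n. *)
  assert (Hsum : exists w : hd, sum_n_m (fun m => power T m x) 1 n =
    plus (scal (RtoC (INR n) * x 0%nat)%C v) w /\
    norm w <= M * ((1 - (1 / 2) ^ n) * norm x)).
  { clear Hn1 HnN Hn0; induction n as [|n (w & Ew & Hw)].
    - exists zero; split.
      + rewrite sum_n_m_zero by lia; apply hahn_eq; intros k; simpl; ring.
      + apply Rle_trans with 0; [|right; ring].
        apply Req_le, (norm_zero (V := hahn_NormedModule d d_ge1)).
    - destruct (H x (S n)) as (w' & Ew' & Hw'); exists (plus w w'); split.
      + rewrite sum_n_Sm by lia; rewrite Ew, Ew'.
        apply hahn_eq; intros k; rewrite S_INR, RtoC_plus; simpl; ring.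
      + apply Rle_trans with (1 := hahn_norm_plus_le _ _); simpl in *; nra. }
  destruct Hsum as (w & Ew & Hw); unfold cesaro_mean; rewrite Ew.
  assert (Hn' : RtoC (INR n) <> 0%C) by (intros E; apply RtoC_inj in E; lra).
  apply Rle_trans with (norm (scal (RtoC (/ INR n)) w)).
  { apply Req_le, (f_equal norm), hahn_eq; intros k; simpl.
    rewrite RtoC_inv by lra; field; auto. }
  rewrite hahn_norm_scalE, Cmod_R, Rabs_pos_eq
    by (apply Rlt_le, Rinv_0_lt_compat, Hn0).
  unfold Rdiv; rewrite (Rmult_comm M), Rmult_assoc; apply Rmult_le_compat_l.
  + apply Rlt_le, Rinv_0_lt_compat, Hn0.
  + apply Rle_trans with (1 := Hw), Rmult_le_compat_l; auto.
    assert (0 <= (1 / 2) ^ n) by (apply pow_le; lra); nra.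
Qed.

(** * Point spectrum and spectrum *)

Lemma operator_diag (lambda : C) (x : hd) (N : nat) :
  vanishes_below N x ->
  minus (scal lambda x) (T x) N = ((lambda - RtoC (/ (INR N + 1))) * x N)%C.
Proof. intros Hx; rewrite hahn_minusE, TE, cesaro_diag by exact Hx; simpl; ring. Qed.

(** Triangularity: once x vanishes below N, coordinate N of the equation reads (lambda - 1/(N+1))
    x_N = 0 with a nonzero factor. *)
Lemma operator_injective (lambda : C) (x : hd) :
  ~ Lambda lambda -> minus (scal lambda x) (T x) = zero -> x = zero.
Proof.
intros Hl Hx; apply hahn_eq; simpl.
enough (H : forall N, vanishes_below N x) by (intros n; apply (H (S n)); lia).
induction N as [|N IH]; intros n Hn; [lia|].
destruct (Nat.eq_dec n N) as [->|]; [|apply IH; lia].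
assert (E := operator_diag lambda x N IH); rewrite Hx in E; simpl in E.
apply NNPP; intros HN; symmetry in E; revert E.
apply Cmult_neq_0; [apply Cminus_eq_contra | exact HN].
intros E; apply Hl; exists N; exact E.
Qed.

Lemma operator_point_spectrum (lambda : C) :
  point_spectrum T lambda <-> Lambda lambda.
Proof.
split.
- intros (x & Hx & E); apply NNPP; intros Hl; apply Hx.
  apply (operator_injective lambda); auto.
  rewrite E; apply hahn_eq; intros n; simpl; ring.
- intros [N ->]; destruct (eigenvector_hahn N) as [v Hv]; exists v; split.
  + intros E; assert (Hz : v N = RtoC 0) by (rewrite E; auto).
    rewrite Hv, eigenvector_diag in Hz; apply RtoC_inj in Hz; lra.
  + apply operator_eigenvector, Hv.
Qed.

Lemma operator_solvable (lambda : C) :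
  ~ Lambda0 lambda -> exists M : R, 0 <= M /\ forall y : hd,
    exists x : hd, minus (scal lambda x) (T x) = y /\ norm x <= M * norm y.
Proof.
intros Hl.
assert (Hl0 : lambda <> 0%C) by (intros E; apply Hl; right; exact E).
set (P := fun N => exists M : R, 0 <= M /\ forall y : hd, vanishes_below N y ->
  exists x : hd, minus (scal lambda x) (T x) = y /\ norm x <= M * norm y).
enough (H : P 0%nat).
{ destruct H as (M & HM & H); exists M; split; auto.
  intros y; apply H; intros n Hn; lia. }
assert (Hc : 0 < Cmod lambda) by (apply Cmod_gt_0, Hl0).
assert (He : 0 < Cmod lambda / 4) by lra.
destruct (operator_small (mkposreal _ He)) as [N HN]; simpl in HN.
apply nat_downward_ind with N.
(* Composing with the truncation [Q], of norm at most 2, makes the smallness on h^N global: the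
   factors 1/4 and 2 give a contraction by 1/2. *)
{ destruct (hahn_truncation N) as (Q & LQ & QE & Qn).
  assert (Qv : forall x, vanishes_below N (Q x)).
  { intros x n Hn; rewrite QE; destruct (lt_dec n N); [auto | lia]. }
  set (A := fun x => scal (/ lambda)%C (T (Q x))).
  assert (LA : is_linear A).
  { unfold A; apply (is_linear_comp Q (fun x => scal (/ lambda)%C (T x)) LQ).
    apply (is_linear_comp T (fun x => scal (/ lambda)%C x) T_linear).
    apply (is_linear_scal_r (K := C_AbsRing)); intros a b; apply Cmult_comm. }
  assert (HA : forall x, norm (A x) <= 1 / 2 * norm x).
  { intros x; unfold A; rewrite hahn_norm_scalE, Cmod_inv by exact Hl0.
    apply Rle_trans with (/ Cmod lambda * (Cmod lambda / 4 * (2 * norm x))).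
    - apply Rmult_le_compat_l; [apply Rlt_le, Rinv_0_lt_compat, Hc|].
      apply Rle_trans with (1 := HN (Q x) (Qv x)).
      apply Rmult_le_compat_l; [lra | apply Qn].
    - right; field; lra. }
  exists (2 * / Cmod lambda); split.
  { apply Rmult_le_pos; [lra | apply Rlt_le, Rinv_0_lt_compat, Hc]. }
  intros y Hy.
  assert (Hsol : exists x : hd, x = plus (scal (/ lambda)%C y) (A x)).
  { apply (contraction_id_minus_onto A (1 / 2) LA ltac:(lra) HA). }
  destruct Hsol as [x Hx].
  assert (Exn : forall n, x n = (/ lambda * (y n + T (Q x) n))%C).
  { intros n; transitivity (plus (scal (/ lambda)%C y) (A x) n).
    - exact (f_equal (fun z : hd => z n) Hx).
    - simpl; ring. }
  (* Both y and T(Qx) vanish below N, hence so does the solution x, and [Q] drops out of the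
     equation. *)
  assert (EQ : Q x = x).
  { apply hahn_eq; intros n; rewrite QE; destruct (lt_dec n N) as [Hn|]; auto.
    rewrite Exn, Hy, (operator_vanishes N (Q x) (Qv x)) by exact Hn; ring. }
  exists x; split.
  - apply hahn_eq; intros n; rewrite hahn_minusE; simpl; rewrite Exn, EQ.
    field; exact Hl0.
  - assert (H1 : norm x <= / Cmod lambda * norm y + 1 / 2 * norm x); [|lra].
    apply Rle_trans with (norm (plus (scal (/ lambda)%C y) (A x))).
    { apply Req_le; exact (f_equal norm Hx). }
    apply Rle_trans with (1 := hahn_norm_plus_le _ _), Rplus_le_compat; [|apply HA].
    rewrite hahn_norm_scalE, Cmod_inv by exact Hl0; apply Rle_refl. }
clear N HN; intros N (M & HM & H); destruct (eigenvector_hahn N) as [v Hv].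
assert (Hv0 : 0 <= norm v) by apply norm_ge_0.
set (mu := (lambda - RtoC (/ (INR N + 1)))%C).
assert (Hmu : mu <> 0%C).
{ apply Cminus_eq_contra; intros E; apply Hl; left; exists N; exact E. }
assert (Hm : 0 < / Cmod mu) by (apply Rinv_0_lt_compat, Cmod_gt_0, Hmu).
exists (/ Cmod mu * norm v + M * (1 + norm v)); split.
{ apply Rplus_le_le_0_compat; apply Rmult_le_pos; lra. }
intros y Hy; destruct (hahn_split N v y Hv Hy) as (z & Hz & Eyz & Hzn).
destruct (H z Hz) as (x & Ex & Hx).
(* On v_N the operator lambda - T acts as multiplication by [mu], so dividing the coefficient y_N by
   [mu] solves that component. *)
exists (plus (scal (/ mu * y N)%C v) x); split.
- transitivity (plus (scal (y N) v) z); [|symmetry; exact Eyz]; rewrite <- Ex.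
  rewrite (linear_plus _ T_linear), (linear_scal _ T_linear).
  rewrite (operator_eigenvector N v Hv).
  assert (El : lambda = (mu + RtoC (/ (INR N + 1)))%C) by (unfold mu; ring).
  apply hahn_eq; intros n; simpl; rewrite El; field; exact Hmu.
- apply Rle_trans with (1 := hahn_norm_plus_le _ _).
  rewrite hahn_norm_scalE, Cmod_mult, Cmod_inv, Rmult_plus_distr_r by exact Hmu.
  apply Rplus_le_compat.
  + rewrite !Rmult_assoc; apply Rmult_le_compat_l; [lra|].
    rewrite Rmult_comm; apply Rmult_le_compat_l; auto.
    apply hahn_norm_ge_coord.
  + apply Rle_trans with (1 := Hx); rewrite Rmult_assoc.
    apply Rmult_le_compat_l; auto.
Qed.

(** Solutions are unique by injectivity, so the function that chooses them inherits linearity and is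
    a two-sided inverse. *)
Lemma operator_resolvent (lambda : C) :
  ~ Lambda0 lambda -> resolvent_set T lambda.
Proof.
intros Hl; destruct (operator_solvable lambda Hl) as (M & HM & H).
apply functional_choice in H; destruct H as [S HS].
assert (SE : forall y, minus (scal lambda (S y)) (T (S y)) = y) by (intros y; apply HS).
assert (Hinj : forall x y : hd, minus (scal lambda x) (T x) =
  minus (scal lambda y) (T y) -> x = y).
{ intros x y E.
  assert (E0 : minus x y = zero).
  { apply (operator_injective lambda); [intros HL; apply Hl; left; exact HL|].
    rewrite (linear_minus _ _ _ T_linear).
    apply hahn_eq; intros n.
    assert (En := f_equal (fun z : hd => z n) E); simpl in *.
    apply Ceq_minus in En; rewrite <- En; ring. }
  apply hahn_eq; intros n.
  assert (En := f_equal (fun z : hd => z n) E0); simpl in En.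
  apply Ceq_minus; rewrite <- En; ring. }
exists S; split; [split|split; [|exact SE]].
- intros x y; apply Hinj; rewrite SE.
  rewrite (linear_plus _ T_linear).
  rewrite <- (SE x) at 1; rewrite <- (SE y) at 1.
  apply hahn_eq; intros n; simpl; ring.
- intros a x; apply Hinj; rewrite SE.
  rewrite (linear_scal _ T_linear).
  rewrite <- (SE x) at 1.
  apply hahn_eq; intros n; simpl; unfold mult; simpl; ring.
- exists (M + 1); split; [lra|]; intros x.
  apply Rle_trans with (1 := proj2 (HS x)), Rmult_le_compat_r; [|lra].
  apply norm_ge_0.
- intros x; apply Hinj; rewrite SE; reflexivity.
Qed.

Lemma operator_spectrum (lambda : C) : spectrum T lambda <-> Lambda0 lambda.
Proof.
split.
- intros H; apply NNPP; intros Hl; apply H, operator_resolvent, Hl.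
- intros Hl (S & LS & S1 & _); destruct Hl as [Hl|Hl].
  + apply operator_point_spectrum in Hl; destruct Hl as (x & Hx & E); apply Hx.
    rewrite <- (S1 x), E, <- (linear_zero S LS); f_equal.
    apply hahn_eq; intros n; simpl; ring.
  (* At 0 a bounded inverse would give [norm v <= M * norm (T v)], contradicted by v_N in a subspace
     h^N where T has norm at most 1/(2M). *)
  + destruct (linear_norm S LS) as (M & HM & HS).
    assert (He : 0 < / (2 * M)) by (apply Rinv_0_lt_compat; lra).
    destruct (operator_small (mkposreal _ He)) as [N HN]; simpl in HN.
    destruct (eigenvector_hahn N) as [v Hv].
    assert (Hv1 : 1 <= norm v).
    { apply Rle_trans with (2 := hahn_norm_ge_coord d d_ge1 v N).
      rewrite Hv, eigenvector_diag, Cmod_1; lra. }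
    assert (HvN : vanishes_below N v).
    { intros n Hn; rewrite Hv, eigenvector_below; auto. }
    assert (H1 : norm v <= M * norm (T v)).
    { rewrite <- (S1 v) at 1; apply Rle_trans with (1 := HS _).
      apply Rmult_le_compat_l, Req_le; [lra|].
      transitivity (norm (scal (- (1))%C (T v))).
      - f_equal; rewrite Hl; apply hahn_eq; intros n; simpl; ring.
      - rewrite hahn_norm_scalE, Cmod_opp, Cmod_1; ring. }
    assert (H2 : M * norm (T v) <= M * (/ (2 * M) * norm v)).
    { apply Rmult_le_compat_l; [lra | apply HN, HvN]. }
    replace (M * (/ (2 * M) * norm v)) with (norm v / 2) in H2 by (field; lra).
    lra.
Qed.

(** * Compactness *)

(** Induction on the number of retained coordinates: each one adds a disc of multiples of the image
    of a coordinate vector, and sums of totally bounded sets are totally bounded. *)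
Lemma truncated_image_totally_bounded (M : R) (N : nat) :
  totally_bounded (fun z : hd => exists x y : hd, norm x <= M /\
    (forall n, y n = if lt_dec n N then x n else RtoC 0) /\ z = T y).
Proof.
induction N as [|N IH].
- intros e; exists (zero :: nil); intros z (x & y & _ & Hy & ->).
  exists zero; split; [left; auto|].
  replace (T y) with (zero : hd).
  + apply Rle_lt_trans with (norm (zero : hd)).
    * apply Req_le, (f_equal norm), hahn_eq; intros n; simpl; ring.
    * apply Rle_lt_trans with (2 := cond_pos e), Req_le.
      apply (norm_zero (V := hahn_NormedModule d d_ge1)).
  + symmetry; transitivity (T zero); [|apply (linear_zero T T_linear)].
    f_equal; apply hahn_eq; intros n; rewrite Hy; reflexivity.
- destruct (hahn_unit N) as [u Hu]; intros e.
  destruct (totally_bounded_plus _ _ IH (totally_bounded_disc M (T u)) e) as [l Hl].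
  exists l; intros z (x & y & Hx & Hy & ->); apply Hl.
  exists (T (minus y (scal (x N) u))), (scal (x N) (T u)); split; [|split].
  + exists x, (minus y (scal (x N) u)); split; [|split]; auto.
    intros n; rewrite hahn_minusE; simpl; rewrite Hy, Hu.
    destruct (lt_dec n N), (lt_dec n (S N)), (Nat.eq_dec n N) as [->|];
      try lia; ring.
  + exists (x N); split; auto.
    apply Rle_trans with (2 := Hx), hahn_norm_ge_coord.
  + rewrite (linear_minus _ _ _ T_linear), (linear_scal _ T_linear).
    apply hahn_eq; intros n; simpl; ring.
Qed.

Lemma operator_compact : compact_operator T.
Proof.
split; [exact T_linear|]; intros B [M HM].
apply (totally_bounded_compact_closure (X := hahn_CompleteNormedModule d d_ge1)).
apply (totally_bounded_approx (X := hahn_NormedModule d d_ge1)); intros e.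
assert (HM' := Rabs_pos M); assert (HMM := Rle_abs M).
(* The discarded tail Qx has norm at most 2 |M|, so this rate makes its image at most e. Using |M| +
   1 keeps the denominator positive for every real [M]. *)
assert (He : 0 < e / (2 * (Rabs M + 1))).
{ apply Rdiv_lt_0_compat; [apply cond_pos | lra]. }
destruct (operator_small (mkposreal _ He)) as [N HN]; simpl in HN.
destruct (hahn_truncation N) as (Q & LQ & QE & Qn).
eexists; split; [apply (truncated_image_totally_bounded M N)|].
intros z (x & Hx & ->); exists (T (minus x (Q x))); split.
- exists x, (minus x (Q x)); split; [apply HM, Hx|]; split; auto.
  intros n; rewrite hahn_minusE, QE; destruct (lt_dec n N); ring.
- apply Rle_trans with (norm (T (Q x))).
  { apply Req_le, (f_equal norm); rewrite (linear_minus _ _ _ T_linear).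
    apply hahn_eq; intros n; simpl; ring. }
  apply Rle_trans with (e / (2 * (Rabs M + 1)) * norm (Q x)).
  { apply HN; intros n Hn; rewrite QE; destruct (lt_dec n N); [auto | lia]. }
  apply Rle_trans with (e / (2 * (Rabs M + 1)) * (2 * (Rabs M + 1))).
  + apply Rmult_le_compat_l; [lra|]; apply Rle_trans with (1 := Qn x).
    apply Rmult_le_compat_l; [lra|]; apply Rle_trans with (1 := HM x Hx); lra.
  + right; field; lra.
Qed.

(** * Failure of supercyclicity *)

(** The functionals y_0 and y_1 - t y_0 are left eigenvectors of the matrix, for the eigenvalues 1
    and 1/2. *)
Lemma power_first_coords (x : hd) (n : nat) :
  power T n x 0%nat = x 0%nat /\
  (power T n x 1%nat - t * power T n x 0%nat)%C =
    (RtoC ((1 / 2) ^ n) * (x 1%nat - t * x 0%nat))%C.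
Proof.
assert (H0 : forall y : hd, T y 0%nat = y 0%nat).
{ intros y; rewrite TE, cesaro_diag; [|intros k Hk; lia].
  simpl; replace (/ (0 + 1)) with 1 by field; ring. }
assert (H1 : forall y : hd, (T y 1%nat - t * T y 0%nat)%C =
                (RtoC (1 / 2) * (y 1%nat - t * y 0%nat))%C).
{ intros y; rewrite H0, TE; unfold cesaro; fold (cesaro_sum t y 1).
  rewrite cesaro_sum_S, cesaro_sum_0; simpl INR.
  replace (1 + 1) with 2 by ring; rewrite RtoC_div by lra.
  field; intros E; apply RtoC_inj in E; lra. }
induction n as [|n [IH0 IH1]]; simpl.
- split; auto; ring.
- change (Nat.iter n T x) with (power T n x).
  rewrite H1, H0, IH1, RtoC_mult; split; [exact IH0 | ring].
Qed.

(* The functional y_1 - t y_0 is halved by T and y_0 is preserved, so on the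
   closure of the projective orbit of x the former is dominated by
   the latter, which fails at the second eigenvector unless x_0 = 0. *)
Lemma operator_not_supercyclic : ~ supercyclic T.
Proof.
intros [x Hx].
(* Coordinates are dominated by the norm, so density yields approximation of all coordinates at
   once. *)
assert (Happ : forall (y : hd) (e : posreal), exists (l : C) (n : nat),
  forall k, Cmod (l * power T n x k - y k)%C < e).
{ intros y e; destruct (Hx y (ball y e) (locally_ball y e)) as (z & (l & n & ->) & Hz).
  exists l, n; intros k; apply Rle_lt_trans with (2 := Hz).
  apply Rle_trans with (2 := hahn_norm_ge_coord d d_ge1 _ k).
  rewrite hahn_minusE; apply Rle_refl. }
set (w := (x 1%nat - t * x 0%nat)%C).
assert (Hx0 : x 0%nat = 0%C).
{ apply NNPP; intros Hx0; apply Cmod_gt_0 in Hx0.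
  assert (Hw := Cmod_ge_0 w).
  (* Approximating v_1 forces |l x_0| < e, hence |l| |w| <= 1/4 by the second bound on [e]. But its
     entry 1 requires 1 <= 2e + |l| |w|, which is at most 3/4. *)
  set (e := Rmin (1 / 4) (Cmod (x 0%nat) / (4 * (Cmod w + 1)))).
  assert (He : 0 < e).
  { apply Rmin_case; [lra | apply Rdiv_lt_0_compat; lra]. }
  assert (He1 : e <= 1 / 4) by apply Rmin_l.
  assert (He2 : e * (4 * (Cmod w + 1)) <= Cmod (x 0%nat)).
  { apply Rle_div_r; [lra | apply Rmin_r]. }
  destruct (eigenvector_hahn 1) as [v Hv].
  destruct (Happ v (mkposreal e He)) as (l & n & H); simpl in H.
  destruct (power_first_coords x n) as [P0 P1]; fold w in P1.
  assert (H0 := H 0%nat); assert (H1 := H 1%nat).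
  rewrite Hv, eigenvector_below, P0 in H0 by lia.
  rewrite Hv, eigenvector_diag in H1.
  replace (l * x 0%nat - 0)%C with (l * x 0%nat)%C in H0 by ring.
  assert (E1 : RtoC 1 = (- (l * power T n x 1%nat - 1) +
    (l * (RtoC ((1 / 2) ^ n) * w) + t * (l * x 0%nat)))%C).
  { rewrite <- P1, P0; ring. }
  assert (Hpn : 0 <= (1 / 2) ^ n <= 1).
  { split; [apply pow_le; lra|].
    apply Rle_trans with (1 ^ n); [apply pow_incr; lra | rewrite pow1; lra]. }
  assert (H2 : 1 <= e + (Cmod l * Cmod w + e)).
  { rewrite <- Cmod_1, E1; apply Rle_trans with (1 := Cmod_triangle _ _).
    apply Rplus_le_compat; [rewrite Cmod_opp; lra|].
    apply Rle_trans with (1 := Cmod_triangle _ _), Rplus_le_compat.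
    - rewrite !Cmod_mult, Cmod_R, Rabs_pos_eq by apply Hpn.
      apply Rmult_le_compat_l; [apply Cmod_ge_0 | nra].
    - rewrite Cmod_mult, Cmod_R, Rabs_pos_eq by exact t_ge0.
      generalize (Cmod_ge_0 (l * x 0%nat)%C); nra. }
  rewrite Cmod_mult in H0; assert (Hl := Cmod_ge_0 l).
  assert (Cmod l * (e * (4 * (Cmod w + 1))) <= e) by nra.
  assert (Cmod l * (4 * (Cmod w + 1)) <= 1); [|nra].
  apply (Rmult_le_reg_l e); [exact He | lra]. }
(* With x_0 = 0 the whole projective orbit has zeroth coordinate 0, at distance 1 from that of
   v_0. *)
destruct (eigenvector_hahn 0) as [v Hv].
destruct (Happ v (mkposreal 1 Rlt_0_1)) as (l & n & H); specialize (H 0%nat).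
destruct (power_first_coords x n) as [P0 _].
rewrite Hv, eigenvector_diag, P0, Hx0 in H; simpl in H.
replace (l * 0 - 1)%C with (- (1))%C in H by ring.
rewrite Cmod_opp, Cmod_1 in H; lra.
Qed.

End Hahn.

Theorem theorem12p6
  (d : nat -> R)
  (d_growing : Un_growing d)
  (d_ge1 : forall n : nat, 1 <= d n)
  (d_infty : is_lim_seq d p_infty)
  (d_shift : forall m : nat,
     Un_decreasing (fun k : nat => d (m + k + 1)%nat / d k))
  (d_ratio_decr : Un_decreasing (fun k : nat => d (k + 1)%nat / d k))
  (d_ratio_lim : is_lim_seq (fun k : nat => d (k + 1)%nat / d k) 1)
  (t : R) (t_ge0 : 0 <= t) (t_lt1 : t < 1) :
  exists T : hahn d d_ge1 -> hahn d d_ge1,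
    (forall (x : hahn d d_ge1) (n : nat), T x n = cesaro t x n) /\
    is_linear T /\
    compact_operator T /\
    (forall lambda : C, point_spectrum T lambda <-> Lambda lambda) /\
    (forall lambda : C, spectrum T lambda <-> Lambda0 lambda) /\
    power_bounded T /\
    uniformly_mean_ergodic T /\
    ~ supercyclic T.
Proof.
destruct (cesaro_operator d d_ge1 d_growing d_ratio_lim t t_ge0 t_lt1)
  as (T & TE & LT).
exists T; split; [exact TE|]; split; [exact LT|]; split; [|split; [|split; [|split; [|split]]]].
- eapply operator_compact; eauto.
- eapply operator_point_spectrum; eauto.
- eapply operator_spectrum; eauto.
- eapply operator_power_bounded; eauto.
- eapply operator_uniformly_mean_ergodic; eauto.
- eapply operator_not_supercyclic; eauto.
Qed.
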